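(* Let $1<q\le2$, $p>1$, and let $[X,\mathcal B,m^i,\nu_i]$ ($i=1,2$) be reversible random walk spaces on the same measurable space with $\nu_2\ll\nu_1$, $\mu=\frac{d\nu_2}{d\nu_1}\in L^\infty(X,\nu_1)$ and $\mu\ge c>0$ $\nu_1$-a.e. Assume either (a) $\nu_1(X)<\infty$; or (b) $\nu_1(X)=+\infty$ and $q\le\frac{p}{p-1}\le2\le p$. Then, with $H=L^2(X,\nu_1)$, $$\partial_H\big(\mathcal F_{q,m^1}+\mathcal F_{p,m^2}\big)=-\Delta_q^{m^1}-\mu\Delta_p^{m^2}.$$ Moreover, this operator is completely accretive and has dense domain in $H$.
   Context: Random walk space $[X,\mathcal B,m,\nu]$: measurable space with countably generated $\sigma$-algebra, probability measures $m_x$ depending measurably on $x$, $\sigma$-finite invariant measure $\nu$ ($\nu(A)=\int m_x(A)\,d\nu(x)$), reversible if $dm_x(y)d\nu(x)=dm_y(x)d\nu(y)$. $\nabla u(x,y)=u(y)-u(x)$. On $H$: $\mathcal F_{q,m^1}(u)=\frac1{2q}\int_{X\times X}|\nabla u|^q\,dm^1_x(y)d\nu_1(x)$ and $\mathcal F_{p,m^2}(u)=\frac1{2p}\int_{X\times X}|\nabla u|^p\,dm^2_x(y)d\nu_2(x)$, each $+\infty$ if infinite. $\partial_H$ is the convex subdifferential. For $s>1$, in a random walk space $[X,\mathcal B,m,\nu]$: $(u,w)\in\Delta_s^m$ iff $u,w\in L^2(X,\nu)$, $\nabla u\in L^s(dm_x(y)d\nu(x))$ and $w(x)=\int_X|\nabla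 u(x,y)|^{s-2}\nabla u(x,y)\,dm_x(y)$. The operator $-\Delta_q^{m^1}-\mu\Delta_p^{m^2}$ on $H$ consists of $(u,v)$, $u,v\in H$, $v=-w_1-\mu w_2$ with $(u,w_1)\in\Delta_q^{m^1}$ (w.r.t. $\nu_1$), $(u,w_2)\in\Delta_p^{m^2}$ (w.r.t. $\nu_2$). Complete accretivity of $A\subset H\times H$: for all $\lambda>0$, $(u_1,v_1),(u_2,v_2)\in A$, $\int j(u_1-u_2)\,d\nu_1\le\int j(u_1-u_2+\lambda(v_1-v_2))\,d\nu_1$ for all convex lower semicontinuous $j:\mathbb R\to[0,\infty]$ with $j(0)=0$. *)

(* Defs.v *)
From HB Require Import structures.
From mathcomp Require Import all_boot all_order all_algebra.
From mathcomp Require Import all_classical all_reals all_analysis.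
Set Implicit Arguments. Unset Strict Implicit. Unset Printing Implicit Defensive.
Import Order.TTheory GRing.Theory Num.Theory numFieldNormedType.Exports.
Local Open Scope classical_set_scope.
Local Open Scope ring_scope.
Local Open Scope ereal_scope.

Section Defs.
Context {d : measure_display} {X : measurableType d} {R : realType}.

Definition countably_generated :=
  exists G : (set X)^nat, [set A | measurable A] = <<s range G >>.

Definition random_walk_space (m : R.-pker X ~> X)
    (nu : {measure set X -> \bar R}) :=
  sigma_finite setT nu /\
  forall A, measurable A -> nu A = \int[nu]_x m x A.

(* reversibility: dm_x(y) dnu(x) = dm_y(x) dnu(y) as measures on X x X *)
Definition reversible (m : R.-pker X ~> X) (nu : {measure set X -> \bar R}) :=
  forall E : set (X * X), measurable E ->
    \int[nu]_x \int[m x]_y (\1_E (x, y))%:E =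
    \int[nu]_x \int[m x]_y (\1_E (y, x))%:E.

(* u is (a representative of) an element of L^2(X, nu) *)
Definition L2 (nu : {measure set X -> \bar R}) (u : X -> R) :=
  measurable_fun setT u /\ \int[nu]_x ((u x) ^+ 2)%:E < +oo.

Definition nabla (u : X -> R) (xy : X * X) : R := u xy.2 - u xy.1.

Definition Fsm (s : R) (m : R.-pker X ~> X) (nu : {measure set X -> \bar R})
    (u : X -> R) : \bar R :=
  ((2 * s)^-1)%:E * \int[nu]_x \int[m x]_y (`|nabla u (x, y)| `^ s)%:E.

Definition subdiff (nu : {measure set X -> \bar R}) (F : (X -> R) -> \bar R)
    (u v : X -> R) :=
  [/\ L2 nu u, L2 nu v, F u \is a fin_num &
      forall w, L2 nu w ->
        F u + \int[nu]_x (v x * (w x - u x))%:E <= F w].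

Definition Delta (s : R) (m : R.-pker X ~> X) (nu : {measure set X -> \bar R})
    (u w : X -> R) :=
  [/\ L2 nu u, L2 nu w,
      \int[nu]_x \int[m x]_y (`|nabla u (x, y)| `^ s)%:E < +oo &
      {ae nu, forall x, (w x)%:E =
         \int[m x]_y ((`|nabla u (x, y)| `^ (s - 2)) * nabla u (x, y))%:E}].

Definition opB (q p : R) (m1 m2 : R.-pker X ~> X)
    (nu1 nu2 : {measure set X -> \bar R}) (mu : X -> R) (u v : X -> R) :=
  [/\ L2 nu1 u, L2 nu1 v &
    exists w1 w2, [/\ Delta q m1 nu1 u w1, Delta p m2 nu2 u w2 &
      {ae nu1, forall x, v x = (- w1 x - mu x * w2 x)%R}]].

Definition convex_ext (j : R -> \bar R) :=
  forall (x y t : R), (0 <= t <= 1)%R ->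
    j (t * x + (1 - t) * y)%R <= t%:E * j x + (1 - t)%:E * j y.

Definition completely_accretive (nu : {measure set X -> \bar R})
    (A : (X -> R) -> (X -> R) -> Prop) :=
  forall (lam : R) u1 v1 u2 v2, (0 < lam)%R -> A u1 v1 -> A u2 v2 ->
    forall j : R -> \bar R, convex_ext j -> lower_semicontinuous j ->
      (forall r, 0 <= j r) -> j 0%R = 0 ->
      \int[nu]_x j (u1 x - u2 x)%R <=
      \int[nu]_x j (u1 x - u2 x + lam * (v1 x - v2 x))%R.

Definition dense_domain (nu : {measure set X -> \bar R})
    (A : (X -> R) -> (X -> R) -> Prop) :=
  forall f, L2 nu f -> forall eps : R, (0 < eps)%R ->
    exists u, (exists v, A u v) /\
      \int[nu]_x ((u x - f x) ^+ 2)%:E < eps%:E.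

End Defs.

(* Main.v *)
Require Import Defs.
From HB Require Import structures.
From mathcomp Require Import all_boot all_order all_algebra.
From mathcomp Require Import all_classical all_reals all_analysis.
From mathcomp Require Import measurable_realfun ring lra.
Set Implicit Arguments. Unset Strict Implicit. Unset Printing Implicit Defensive.
Import Order.TTheory GRing.Theory Num.Theory numFieldNormedType.Exports.
Local Open Scope classical_set_scope.
Local Open Scope ring_scope.
Local Open Scope ereal_scope.

(** Write E for the measure nu(dx) m_x(dy) on X x X; by reversibility E is invariant
    under exchanging x and y.  For g antisymmetric with w(x) = \int g(x, y) dm_x(y) this
    gives Green's formula  \int g \nabla f dE = - 2 \int w f dnu  as soon as g(x, y) f(x)
    is E-integrable, which holds for g = |\nabla u|^(s-2) \nabla u and every bounded f
    supported on a set of finite measure.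

    If f is in L^2 and \nabla f in L^s, the functions h_n(f), with h_n 1-Lipschitz, bounded
    and vanishing near 0, h_n -> id, are of that kind, and dominated convergence extends
    Green's formula to f.  With the gradient inequality for |.|^s (a form of Young's
    inequality) this shows that the operator is contained in the subdifferential.

    Conversely, testing the subdifferential inequality with u + t f and letting t -> 0
    gives v = - w_1 - mu w_2 a.e.  The assumptions on q and p serve to see that w_1
    and w_2 are separately in L^2:  with G_1(x) = \int |\nabla u|^q dm^1_x, one has
    w_1^2 <= 4 + 4 G_1, which is enough on sets of finite measure, and
    w_2^2 <= 4 G_2 where G_2(x) = \int |\nabla u|^p dm^2_x is at most 1 if p >= 2.

    For complete accretivity, j is the limit of an increasing sequence of finite maxima of
    affine functions vanishing near 0.  Such a maximum g has a bounded nondecreasing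
    subgradient r vanishing near 0, so Green's formula applies to r(u_1 - u_2) and yields
    \int r(u_1 - u_2) (v_1 - v_2) >= 0 by monotonicity of |.|^(s-2)(.).

    The domain is dense because it contains all bounded functions supported on a set of
    finite measure. *)

(** * Integration along a kernel *)
Section mixture.
Context d d' (X : measurableType d) (Z : measurableType d') (R : realType).
Variables (nu : {measure set X -> \bar R}) (k : X -> {measure set Z -> \bar R}).
Variable kappa : {measure set Z -> \bar R}.
Hypothesis mk : forall U, measurable U -> measurable_fun [set: X] (k ^~ U).
Hypothesis kappaE : forall U, measurable U -> kappa U = \int[nu]_x (k x U : \bar R).

Import HBNNSimple.

Let sintegral_mixture (h : {nnsfun Z >-> R}) :
  sintegral kappa h = \int[nu]_x sintegral (k x) h.
Proof.
under eq_integral do rewrite sintegralE.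
rewrite ge0_integral_fsum//; last 2 first.
  by move=> r; apply: measurable_funeM; exact: mk.
  by move=> r x _; exact: nnsfun_mulemu_ge0.
rewrite sintegralE /=; apply: eq_fsbigr => // r rh.
have [r0|r0] := leP 0%R r.
  rewrite ge0_integralZl//; last exact: mk.
  by rewrite kappaE.
rewrite preimage_nnfun0// measure0 mule0.
by rewrite integral0_eq// => x _; rewrite measure0 mule0.
Qed.

(** Holds for simple functions by linearity, then by monotone convergence on both sides. Since [k]
    is any family of measures with measurable evaluations, this covers weighted point masses as well
    as images of [m x]. *)
Lemma ge0_integral_mixture (f : Z -> \bar R) :
  measurable_fun [set: Z] f -> (forall z, 0 <= f z) ->
  \int[kappa]_z f z = \int[nu]_x \int[k x]_z f z.
Proof.
move=> mf f0.
pose g := nnsfun_approx measurableT mf.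
pose gE := fun n => EFin \o g n.
have mgE n : measurable_fun [set: Z] (gE n) by exact/measurable_EFinP.
have gE_ge0 n x : 0 <= gE n x by rewrite lee_fin.
have nd_gE x : {homo gE ^~ x : n m / (n <= m)%O >-> n <= m}.
  by move=> *; exact/lefP/nd_nnsfun_approx.
transitivity (limn (fun n => \int[kappa]_x gE n x)).
  rewrite -monotone_convergence//; apply: eq_integral => t _.
  by apply/esym/cvg_lim => //; exact: cvg_nnsfun_approx.
transitivity (limn (fun n => \int[nu]_x \int[k x]_z gE n z)).
  apply: congr_lim; apply/funext => n.
  rewrite integralT_nnsfun sintegral_mixture; apply: eq_integral => x _.
  by rewrite integralT_nnsfun.
rewrite -[LHS]monotone_convergence//; last 3 first.
  by move=> n; exact: measurable_fun_integral_kernel.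
  by move=> n x _; exact: integral_ge0.
  by move=> x _ m n mn; apply: ge0_le_integral => // t _; exact: nd_gE.
apply: eq_integral => x _.
rewrite -monotone_convergence//.
apply: eq_integral => t _.
by apply/cvg_lim => //; exact: cvg_nnsfun_approx.
Qed.

End mixture.

(** A measure with density [mu] is the mixture over [x] of the Dirac masses at [x] with weight
    [mu x]. *)
Lemma ge0_integral_density d (X : measurableType d) (R : realType)
    (nu1 nu2 : {measure set X -> \bar R}) (mu : X -> R) (f : X -> \bar R) :
  measurable_fun [set: X] mu -> (forall x, 0 <= mu x)%R ->
  (forall A, measurable A -> nu2 A = \int[nu1]_(x in A) (mu x)%:E) ->
  measurable_fun [set: X] f -> (forall x, 0 <= f x) ->
  \int[nu2]_x f x = \int[nu1]_x ((mu x)%:E * f x).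
Proof.
move=> mmu mu0 nu2E mf f0.
pose k x : {measure set X -> \bar R} := mscale (NngNum (mu0 x)) (dirac x).
have kE U x : k x U = (mu x * \1_U x)%:E by rewrite /k/= /mscale/= diracE indicE EFinM.
rewrite (@ge0_integral_mixture _ _ _ _ _ nu1 k nu2)//.
- apply: eq_integral => x _.
  by rewrite ge0_integral_mscale//= integral_dirac//= diracT mul1e.
- move=> U mU; under eq_fun do rewrite kE.
  by apply/measurable_EFinP; apply: measurable_funM.
- move=> U mU; rewrite nu2E// integral_mkcond; apply: eq_integral => x _.
  by rewrite kE patchE indicE; case: ifPn => _; rewrite ?mulr1 ?mulr0.
Qed.

(** * The measure nu(dx) m_x(dy) on pairs of points *)

Section edge_measure.
Context d (X : measurableType d) (R : realType).
Variables (m : R.-pker X ~> X) (nu : {measure set X -> \bar R}).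

Definition edge (U : set (X * X)) : \bar R := \int[nu]_x m x (xsection U x).

Let edge0 : edge set0 = 0.
Proof. by rewrite /edge integral0_eq// => x _; rewrite xsection0 measure0. Qed.

Let edge_ge0 U : 0 <= edge U.
Proof. exact: integral_ge0. Qed.

Let measurable_xsection_kernel (U : set (X * X)) : measurable U ->
  measurable_fun [set: X] (fun x => m x (xsection U x)).
Proof.
move=> mU.
rewrite (_ : (fun _ => _) = (fun x => \int[m x]_y (\1_U (x, y))%:E)).
  apply: (measurable_fun_integral_sfinite_kernel (fun xy => (\1_U xy)%:E) m) => //.
  exact/measurable_EFinP.
apply/funext => x; rewrite (_ : (fun y => _) = (fun y => (\1_(xsection U x) y)%:E)).
  by rewrite integral_indic ?setIT//; exact: measurable_xsection.
by apply/funext => y; rewrite !indicE; congr (_%:R%:E); rewrite mem_xsection.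
Qed.

Let edge_sigma_additive : semi_sigma_additive edge.
Proof.
move=> U mU tU mUU; rewrite [X in _ --> X](_ : _ =
  \int[nu]_x (\sum_(n <oo) m x (xsection (U n) x))); last first.
  apply: eq_integral => x _; rewrite xsection_bigcup.
  apply/esym/cvg_lim => //; apply: measure_semi_sigma_additive.
  - by move=> n; exact: measurable_xsection.
  - exact: trivIset_xsection.
  - by apply: bigcup_measurable => n _; exact: measurable_xsection.
apply/cvg_closeP; split.
  by apply: is_cvg_nneseries => n _ _; exact: integral_ge0.
rewrite closeE// integral_nneseries// => n.
exact: measurable_xsection_kernel.
Qed.

HB.instance Definition _ := isMeasure.Build _ _ _ edge
  edge0 edge_ge0 edge_sigma_additive.

Let pairm x : X -> X * X := fun y => (x, y).
Let mpairm x : measurable_fun setT (pairm x).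
Proof. exact: measurable_pair1. Qed.

(** [edge] is the mixture of the images of [m x] under y -> (x, y), so this is Tonelli's formula for
    it. *)
Lemma ge0_integral_edge (f : X * X -> \bar R) :
  measurable_fun [set: X * X] f -> (forall z, 0 <= f z) ->
  \int[edge]_z f z = \int[nu]_x \int[m x]_y f (x, y).
Proof.
move=> mf f0.
pose kp x : {measure set (X * X) -> \bar R} := pushforward (m x) (pairm x).
pose k := kp mpairm.
have kE U x : k x U = m x (xsection U x).
  rewrite /k /kp/= /pushforward; congr (m x _); apply/seteqP.
  by split=> y /=; rewrite /xsection/= inE.
rewrite (@ge0_integral_mixture _ _ _ _ _ nu k)//.
- apply: eq_integral => x _.
  by rewrite (@ge0_integral_pushforward _ _ _ _ _ (pairm x) (mpairm x))//= preimage_setT.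
- move=> U mU; under eq_fun do rewrite kE.
  exact: measurable_xsection_kernel.
- by move=> U mU; apply: eq_integral => x _; rewrite kE.
Qed.

End edge_measure.

(** * Integrable real functions and Green's formula *)
Section real_integrable.
Context d (T : measurableType d) (R : realType).
Variable nu : {measure set T -> \bar R}.
Implicit Types f g : T -> R.

Definition rintegrable f := nu.-integrable setT (EFin \o f).

Lemma rintegrable_measurable f : rintegrable f -> measurable_fun setT f.
Proof. by move=> /measurable_int /measurable_EFinP. Qed.

Lemma rintegralE f : rintegrable f ->
  \int[nu]_x (f x)%:E = ((\int[nu]_x f x)%R)%:E.
Proof. by move=> fi; rewrite fineK//; exact: integrable_fin_num. Qed.

Lemma rintegrable_le g f : rintegrable g -> measurable_fun setT f ->
  (forall x, `|f x| <= g x)%R -> rintegrable f.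
Proof.
move=> gi mf fg; apply: le_integrable gi => //; first exact/measurable_EFinP.
move=> x _ /=; rewrite lee_fin (le_trans (fg x))//; exact: ler_norm.
Qed.

Lemma rintegrable_ge0 f : measurable_fun setT f -> (forall x, 0 <= f x)%R ->
  \int[nu]_x (f x)%:E < +oo -> rintegrable f.
Proof.
move=> mf f0 fi; apply/integrableP; split; first exact/measurable_EFinP.
by under eq_integral do rewrite /= ger0_norm//.
Qed.

Lemma rintegrableD f g : rintegrable f -> rintegrable g ->
  rintegrable (fun x => f x + g x)%R.
Proof. by move=> fi gi; exact: (integrableD measurableT fi gi). Qed.

Lemma rintegrableB f g : rintegrable f -> rintegrable g ->
  rintegrable (fun x => f x - g x)%R.
Proof. by move=> fi gi; exact: (integrableB measurableT fi gi). Qed.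

Lemma rintegrableZ k f : rintegrable f -> rintegrable (fun x => k * f x)%R.
Proof. by move=> fi; exact: (integrableZl measurableT k fi). Qed.

Lemma rintegrable_ext g f : f =1 g -> rintegrable g -> rintegrable f.
Proof. by move=> fg; have -> : f = g by exact/funext. Qed.

Lemma rintegral_ext g f : f =1 g -> (\int[nu]_x f x = \int[nu]_x g x)%R.
Proof. by move=> fg; have -> : f = g by exact/funext. Qed.

Lemma rintegralD f g : rintegrable f -> rintegrable g ->
  (\int[nu]_x (f x + g x) = \int[nu]_x f x + \int[nu]_x g x)%R.
Proof. by move=> fi gi; rewrite RintegralD. Qed.

Lemma rintegralB f g : rintegrable f -> rintegrable g ->
  (\int[nu]_x (f x - g x) = \int[nu]_x f x - \int[nu]_x g x)%R.
Proof. by move=> fi gi; rewrite RintegralB. Qed.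

Lemma rintegralZ k f : rintegrable f ->
  (\int[nu]_x (k * f x) = k * \int[nu]_x f x)%R.
Proof. by move=> fi; rewrite RintegralZl. Qed.

Lemma rintegral_le f g : rintegrable f -> rintegrable g ->
  (forall x, f x <= g x)%R -> (\int[nu]_x f x <= \int[nu]_x g x)%R.
Proof. by move=> fi gi fg; apply: le_Rintegral. Qed.

Lemma rintegral_ae f g : measurable_fun setT f -> measurable_fun setT g ->
  {ae nu, forall x, f x = g x} -> (\int[nu]_x f x = \int[nu]_x g x)%R.
Proof.
move=> mf mg fg; congr fine; apply: ae_eq_integral => //;
  [exact/measurable_EFinP|exact/measurable_EFinP|].
by apply: filterS fg => x /= ->.
Qed.

Lemma rintegral_dominated_cvg (f_ : nat -> T -> R) f g :
  (forall n, measurable_fun setT (f_ n)) ->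
  (forall x, f_ ^~ x @ \oo --> f x) -> rintegrable g ->
  (forall n x, `|f_ n x| <= g x)%R ->
  rintegrable f /\ (\int[nu]_x f_ n x)%R @[n --> \oo] --> (\int[nu]_x f x)%R.
Proof.
move=> mf_ cf gi fg.
have mf : measurable_fun setT f.
  by apply: (measurable_fun_cvg mf_) => x _; exact: cf.
have := @dominated_convergence _ _ _ nu setT measurableT
  (fun n => EFin \o f_ n) (EFin \o f) (EFin \o g).
case.
- by move=> n; exact/measurable_EFinP.
- exact/measurable_EFinP.
- by apply: aeW => x _ /=; apply: cvg_EFin; [exact: nearW|exact: cf].
- exact: gi.
- by apply: aeW => x n _ /=; rewrite lee_fin.
move=> fi _ cvI; split => //.
apply: fine_cvg.
rewrite -[X in _ --> X]/(((\int[nu]_x f x)%R)%:E) -rintegralE//.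
Qed.

End real_integrable.

Section edge_fubini.
Context d (X : measurableType d) (R : realType).
Variables (m : R.-pker X ~> X) (nu : {measure set X -> \bar R}).
Local Notation E := (edge m nu).

Lemma measurable_kernel_integral (f : X * X -> R) : measurable_fun setT f ->
  measurable_fun setT (fun x => \int[m x]_y (f (x, y))%:E).
Proof.
move=> mf; have mf' : measurable_fun setT (EFin \o f) by exact/measurable_EFinP.
rewrite (_ : (fun x => _) = (fun x => \int[m x]_y (EFin \o f)^\+ (x, y)) \-
    (fun x => \int[m x]_y (EFin \o f)^\- (x, y))); last first.
  apply/funext => x; rewrite [LHS]integralE; congr (_ - _).
  - by apply: eq_integral => y _; rewrite !funeposE.
  - by apply: eq_integral => y _; rewrite !funenegE.
apply: emeasurable_funB.
- apply: (measurable_fun_integral_sfinite_kernel ((EFin \o f)^\+) m) => //.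
  exact: measurable_funepos.
- apply: (measurable_fun_integral_sfinite_kernel ((EFin \o f)^\-) m) => //.
  exact: measurable_funeneg.
Qed.

(** Fubini, from Tonelli on the positive and negative parts. The inner integral stays extended-real,
    since it may be infinite on a null set of [x]. *)
Lemma integrable_edge (f : X * X -> R) : rintegrable E f ->
  nu.-integrable setT (fun x => \int[m x]_y (f (x, y))%:E) /\
  \int[nu]_x \int[m x]_y (f (x, y))%:E = ((\int[E]_z f z)%R)%:E.
Proof.
move=> fi; have mf := rintegrable_measurable fi.
have mf' : measurable_fun setT (EFin \o f) by exact/measurable_EFinP.
have mp : measurable_fun setT (fun x => \int[m x]_y (EFin \o f)^\+ (x, y)).
  apply: (measurable_fun_integral_sfinite_kernel ((EFin \o f)^\+) m) => //.
  exact: measurable_funepos.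
have mn : measurable_fun setT (fun x => \int[m x]_y (EFin \o f)^\- (x, y)).
  apply: (measurable_fun_integral_sfinite_kernel ((EFin \o f)^\-) m) => //.
  exact: measurable_funeneg.
have ip : nu.-integrable setT (fun x => \int[m x]_y (EFin \o f)^\+ (x, y)).
  apply/integrableP; split => //.
  under eq_integral do rewrite gee0_abs ?integral_ge0//.
  rewrite -ge0_integral_edge//; last exact: measurable_funepos.
  exact: integral_funepos_lt_pinfty.
have inn : nu.-integrable setT (fun x => \int[m x]_y (EFin \o f)^\- (x, y)).
  apply/integrableP; split => //.
  under eq_integral do rewrite gee0_abs ?integral_ge0//.
  rewrite -ge0_integral_edge//; last exact: measurable_funeneg.
  exact: integral_funeneg_lt_pinfty.
have -> : (fun x => \int[m x]_y (f (x, y))%:E) =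
    (fun x => \int[m x]_y (EFin \o f)^\+ (x, y)) \-
    (fun x => \int[m x]_y (EFin \o f)^\- (x, y)).
  apply/funext => x; rewrite [LHS]integralE; congr (_ - _).
  - by apply: eq_integral => y _; rewrite !funeposE.
  - by apply: eq_integral => y _; rewrite !funenegE.
split; first exact: integrableB.
rewrite -rintegralE// integralB// [RHS]integralE.
by rewrite -!ge0_integral_edge//; [exact: measurable_funeneg|exact: measurable_funepos].
Qed.

Hypothesis rev : reversible m nu.

Let swp (z : X * X) : X * X := (z.2, z.1).
Let mswp : measurable_fun setT swp.
Proof. exact: measurable_swap. Qed.

(** [reversible] says exactly that [E] and its image under the exchange of coordinates agree on
    measurable sets. *)
Lemma ge0_integral_edge_swap (f : X * X -> \bar R) :
  measurable_fun setT f -> (forall z, 0 <= f z) ->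
  \int[E]_z f (z.2, z.1) = \int[E]_z f z.
Proof.
move=> mf f0; have EE U : measurable U -> \int[E]_z (\1_U z)%:E = E U.
  by move=> mU; rewrite integral_indic// setIT.
rewrite [RHS](eq_measure_integral (pushforward E swp)).
- by rewrite (ge0_integral_pushforward mswp)//= preimage_setT.
- move=> U mU _; have mU' : measurable (swp @^-1` U).
    by rewrite -[X in measurable X]setTI; exact: mswp.
  transitivity (E (swp @^-1` U)); last by [].
  transitivity (E U); first by [].
  rewrite -(EE U)// -(EE (swp @^-1` U))// !ge0_integral_edge//.
  + exact: rev.
  + exact/measurable_EFinP.
  + exact/measurable_EFinP.
Qed.

Lemma rintegrable_edge_swap (f : X * X -> R) : rintegrable E f ->
  rintegrable E (fun z => f (z.2, z.1)) /\
  (\int[E]_z f (z.2, z.1) = \int[E]_z f z)%R.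
Proof.
move=> fi; have mf := rintegrable_measurable fi.
have mf' : measurable_fun setT (EFin \o f) by exact/measurable_EFinP.
split.
  apply/integrableP; split.
    by apply/measurable_EFinP; exact: (measurableT_comp mf mswp).
  rewrite (ge0_integral_edge_swap (f := fun z => `|(f z)%:E|))//; last first.
    by apply: measurableT_comp.
  by case/integrableP : fi.
congr fine; rewrite integralE [RHS]integralE; congr (_ - _).
- rewrite -[RHS](ge0_integral_edge_swap (f := (EFin \o f)^\+))//.
    by apply: eq_integral => y _; rewrite !funeposE.
  exact: measurable_funepos.
- rewrite -[RHS](ge0_integral_edge_swap (f := (EFin \o f)^\-))//.
    by apply: eq_integral => y _; rewrite !funenegE.
  exact: measurable_funeneg.
Qed.

(** Exchanging coordinates turns g(x, y) phi(y) into g(y, x) phi(x) = - g(x, y) phi(x). Hence the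
    two halves of g \nabla phi are integrable together and contribute equally, whence the factor -
    2. *)
Lemma edge_green (g : X * X -> R) (w phi : X -> R) :
  measurable_fun setT g -> (forall z, g (z.2, z.1) = - g z)%R ->
  measurable_fun setT w -> measurable_fun setT phi ->
  {ae nu, forall x, (w x)%:E = \int[m x]_y (g (x, y))%:E} ->
  rintegrable E (fun z => g z * phi z.1)%R ->
  [/\ rintegrable E (fun z => g z * nabla phi z)%R,
      rintegrable nu (fun x => w x * phi x)%R &
      (\int[E]_z (g z * nabla phi z) = - 2 * \int[nu]_x (w x * phi x))%R].
Proof.
move=> mg gN mw mphi wE gphi.
have [i1 e1] := integrable_edge gphi.
have [i2 e2] := rintegrable_edge_swap gphi.
have mwphi : measurable_fun setT (fun x => w x * phi x)%R.
  exact: measurable_funM.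
have ae1 : {ae nu, forall x, \int[m x]_y (g (x, y) * phi x)%:E = (w x * phi x)%:E}.
  apply: filterS wE => x wx.
  have mgx : measurable_fun setT (fun y => g (x, y)).
    exact: measurableT_comp.
  under eq_integral do rewrite EFinM.
  rewrite integralZr//; first by rewrite -wx EFinM.
  apply/integrableP; split; first exact/measurable_EFinP.
  (* A finite inner integral forces integrability of g(x, .), because the difference of two infinite
     parts is infinite by convention. *)
  by rewrite integral_fin_num_abs// -wx.
have wphi : rintegrable nu (fun x => w x * phi x)%R.
  apply/integrableP; split; first exact/measurable_EFinP.
  move/integrableP : i1 => [mi1]; apply: le_lt_trans.
  rewrite le_eqVlt; apply/orP; left; apply/eqP; apply: ae_eq_integral => //.
  - by apply: measurableT_comp => //; exact/measurable_EFinP.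
  - by apply: measurableT_comp.
  - by apply: filterS ae1 => x /= ->.
have eI : (\int[E]_z (g z * phi z.1) = \int[nu]_x (w x * phi x))%R.
  apply: EFin_inj; rewrite -e1 -rintegralE//; apply: ae_eq_integral => //.
  - by case/integrableP : i1.
  - exact/measurable_EFinP.
  - by apply: filterS ae1 => x /= ->.
have i2' : rintegrable E (fun z => g z * phi z.2)%R.
  apply: rintegrable_ext (rintegrableZ (-1) i2) => z /=.
  by rewrite gN; ring.
have e2' : (\int[E]_z (g z * phi z.2) = - \int[E]_z (g z * phi z.1))%R.
  rewrite -e2 -[RHS]mulN1r -rintegralZ//; apply: rintegral_ext => z /=.
  by rewrite gN; ring.
have e z : (g z * nabla phi z = g z * phi z.2 - g z * phi z.1)%R.
  by rewrite /nabla; ring.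
split => //.
- by apply: rintegrable_ext e _; exact: rintegrableB.
- transitivity (\int[E]_z (g z * phi z.2 - g z * phi z.1))%R.
    exact: rintegral_ext.
  by rewrite rintegralB// e2' eI; ring.
Qed.

End edge_fubini.

(** * Powers and truncations *)
Section power.
Local Open Scope ring_scope.
Context {R : realType}.
Implicit Types (s a b r e : R).

(** The derivative of |r|^s / s. The factor [r] fixes the value 0 at the origin, whatever the power
    of 0 with the possibly negative exponent [s - 2] is. *)
Definition phi s r := `|r| `^ (s - 2) * r.

Lemma phi0 s : phi s 0 = 0. Proof. by rewrite /phi mulr0. Qed.

Lemma phiN s r : phi s (- r) = - phi s r.
Proof. by rewrite /phi normrN mulrN. Qed.

Lemma normr_phi s r : 1 < s -> `|phi s r| = `|r| `^ (s - 1).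
Proof.
move=> s1; have [->|r0] := eqVneq r 0.
  by rewrite phi0 normr0 powR0// subr_eq0 gt_eqF.
rewrite /phi normrM (ger0_norm (powR_ge0 _ _)).
rewrite (_ : s - 1 = s - 2 + 1); last by ring.
by rewrite [RHS]powRD ?normr_eq0 ?r0 ?implybT// powRr1.
Qed.

Lemma phiM s r : 1 < s -> phi s r * r = `|r| `^ s.
Proof.
move=> s1; have [->|r0] := eqVneq r 0.
  by rewrite phi0 normr0 mulr0 powR0// gt_eqF// (lt_trans ltr01).
rewrite /phi -mulrA -expr2 -real_normK ?num_real// expr2 mulrA.
have nr0 : `|r| != 0 by rewrite normr_eq0.
rewrite {2 3}(_ : `|r| = `|r| `^ 1); last by rewrite powRr1.
by rewrite -!powRD ?nr0 ?implybT//; congr (_ `^ _); ring.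
Qed.

(** Young's inequality for |a|^(s-1) and |b| with the conjugate exponents s/(s-1) and s, multiplied
    by [s]. *)
Lemma phi_young s a b : 1 < s ->
  s * (`|phi s a| * `|b|) <= (s - 1) * `|a| `^ s + `|b| `^ s.
Proof.
move=> s1; have s0 : 0 < s by rewrite (lt_trans ltr01).
have s10 : 0 < s - 1 by rewrite subr_gt0.
rewrite normr_phi//.
have t0 : 0 < s / (s - 1) by rewrite divr_gt0.
have := @conjugate_powR R (`|a| `^ (s - 1)) `|b| (s / (s - 1)) s
  (powR_ge0 _ _) (normr_ge0 _) t0 s0.
have -> : (s / (s - 1))^-1 + s^-1 = 1 by field; rewrite !gt_eqF.
move=> /(_ erefl).
rewrite -powRrM (_ : (s - 1) * (s / (s - 1)) = s); last by field; rewrite gt_eqF.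
move=> h; have := ler_wpM2l (ltW s0) h.
rewrite mulrDr invf_div; congr (_ <= _ + _); field; by rewrite gt_eqF.
Qed.

(** Young's inequality again, after writing |a|^s as [phi s a * a]; no differentiation is
    involved. *)
Lemma powR_subgradient s a b : 1 < s ->
  `|a| `^ s + s * (phi s a * (b - a)) <= `|b| `^ s.
Proof.
move=> s1; have := phi_young a b s1; have s0 : 0 < s by rewrite (lt_trans ltr01).
have : phi s a * b <= `|phi s a| * `|b| by rewrite -normrM ler_norm.
by rewrite mulrBr phiM// => h; have := ler_wpM2l (ltW s0) h; lra.
Qed.

Lemma normr_phiM_le s a b : 1 < s ->
  `|phi s a * b| <= `|a| `^ s + `|b| `^ s.
Proof.
move=> s1; have s0 : 0 < s by rewrite (lt_trans ltr01).
rewrite normrM -(ler_pM2l s0) (le_trans (phi_young a b s1))//.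
have := powR_ge0 `|a| s; have := powR_ge0 `|b| s; nra.
Qed.

(** Add the gradient inequalities at [a] and at [b]. *)
Lemma phi_nondecreasing s a b : 1 < s -> a <= b -> phi s a <= phi s b.
Proof.
move=> s1; rewrite le_eqVlt => /predU1P[->//|ab].
have s0 : 0 < s by rewrite (lt_trans ltr01).
have h1 := powR_subgradient a b s1; have h2 := powR_subgradient b a s1.
have : s * ((phi s a - phi s b) * (b - a)) <= 0 by lra.
by rewrite pmulr_rle0// pmulr_lle0 ?subr_gt0// subr_le0.
Qed.

Lemma powRD_le s a b : 0 <= s -> 0 <= a -> 0 <= b ->
  (a + b) `^ s <= 2 `^ s * (a `^ s + b `^ s).
Proof.
move=> s0; wlog ab : a b / a <= b.
  move=> h a0 b0; have [ab|/ltW ba] := leP a b; first exact: h.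
  by rewrite addrC [X in _ * X]addrC; exact: h.
move=> a0 b0; apply: (@le_trans _ _ ((2 * b) `^ s)).
  by rewrite ge0_ler_powR// ?nnegrE ?addr_ge0 ?mulr_ge0//; lra.
by rewrite powRM// ler_wpM2l ?powR_ge0// lerDr powR_ge0.
Qed.

Lemma normrD_powR_le s a b : 0 <= s ->
  `|a + b| `^ s <= 2 `^ s * (`|a| `^ s + `|b| `^ s).
Proof.
move=> s0; apply: le_trans (powRD_le s0 (normr_ge0 a) (normr_ge0 b)).
by rewrite ge0_ler_powR// ?nnegrE ?addr_ge0// ler_normD.
Qed.

(* If a <= e this is e `^ (s - 1) <= e; otherwise a `^ (s - 1) = a `^ s / a. *)
Lemma powRB1_le s a e : 1 < s -> 0 <= a -> 0 < e -> e `^ (s - 1) <= e ->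
  a `^ (s - 1) <= e + e^-1 * a `^ s.
Proof.
move=> s1 a0 e0 ee; have [ae|ea] := leP a e.
  rewrite (@le_trans _ _ (e `^ (s - 1)))//.
    by rewrite ge0_ler_powR// ?nnegrE ?subr_ge0 ltW.
  by rewrite (le_trans ee)// lerDl mulr_ge0 ?powR_ge0// invr_ge0 ltW.
have a1 : 0 < a by rewrite (lt_trans e0).
have s0 : 0 < s by rewrite (lt_trans ltr01).
rewrite -(mulr_powRB1 a0 s0) mulrA.
rewrite (@le_trans _ _ ((e^-1 * a) * a `^ (s - 1)))//; last by rewrite lerDr ltW.
rewrite ler_peMl ?powR_ge0// mulrC ler_pdivlMr// mul1r; exact: ltW.
Qed.

Lemma powRB1_le1 s a : 1 < s -> 0 <= a -> a `^ (s - 1) <= 1 + a `^ s.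
Proof.
by move=> s1 a0; have := @powRB1_le s a 1 s1 a0 ltr01; rewrite powR1 invr1 mul1r; exact.
Qed.

Lemma measurable_phi s : measurable_fun setT (phi s).
Proof.
apply: measurable_funM => //.
exact: (measurableT_comp (@measurable_powR R (s - 2)) (@normr_measurable R setT)).
Qed.

(** At 0, |phi s r| = |r|^(s-1) is below e as soon as |r| < e^(1/(s-1)). Elsewhere the power is
    exp((s-2) ln |r|). *)
Lemma continuous_phi s : 1 < s -> continuous (phi s).
Proof.
move=> s1 a; have s10 : 0 < s - 1 by rewrite subr_gt0.
have [->|a0] := eqVneq a 0.
  rewrite /continuous_at phi0; apply/cvgr0Pnorm_lt => e e0.
  have d0 : 0 < e `^ (s - 1)^-1 by exact: powR_gt0.
  near=> r; rewrite normr_phi//.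
  have rd : `|r| < e `^ (s - 1)^-1.
    by near: r; apply: (@cvgr0_norm_lt _ _ _ (nbhs (0 : R)) _ id) => //; exact: cvg_id.
  have := gt0_ltr_powR s10 (normr_ge0 r) (ltW d0) rd.
  by rewrite -powRrM mulVf ?gt_eqF// powRr1// ltW.
have na : 0 < `|a| by rewrite normr_gt0.
apply: cvgM; last exact: cvg_id.
apply: (@cvg_trans _ (expR ((s - 2) * ln `|r|) @[r --> a])).
  apply: near_eq_cvg; near=> r; rewrite /powR gt_eqF// normr_gt0.
  near: r; exists `|a| => //= r /=.
  by apply: contraTneq => ->; rewrite subr0 ltxx.
rewrite /powR gt_eqF//.
apply: (@continuous_comp _ _ _ (fun r => (s - 2) * ln `|r|) expR); last exact: continuous_expR.
apply: cvgM; first exact: cvg_cst.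
apply: (@continuous_comp R R R (fun r : R => `|r|) (@ln R)).
  exact: norm_continuous.
exact: continuous_ln.
Unshelve. all: by end_near. Qed.

End power.

Section truncation.
Local Open Scope ring_scope.
Context {R : realType}.
Implicit Types (c r x y : R).

Definition clamp c r := Num.max (- c) (Num.min r c).

(* 1-Lipschitz, bounded, and vanishing near 0: a function of this form maps L^2
   functions to bounded functions supported on a set of finite measure. *)
Definition soft_trunc (n : nat) r := clamp n.+1%:R r - clamp n.+1%:R^-1 r.

Lemma clampP c r : 0 <= c ->
  [\/ r <= - c /\ clamp c r = - c, - c <= r <= c /\ clamp c r = r |
      c <= r /\ clamp c r = c].
Proof.
move=> c0; rewrite /clamp; have [rc|cr] := leP r c.
  have [rc'|rc'] := leP (- c) r.
    by apply: Or32.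
  by apply: Or31; split => //; exact: ltW.
apply: Or33; split; first exact: ltW.
by apply/max_idPr; lra.
Qed.

Let clampB c c' x y : 0 <= c <= c' -> x <= y ->
  0 <= (clamp c' y - clamp c y) - (clamp c' x - clamp c x) <= y - x.
Proof.
move=> /andP[c0 cc'] xy; have c'0 := le_trans c0 cc'.
by case: (clampP x c0) => -[? ->]; case: (clampP x c'0) => -[? ->];
  case: (clampP y c0) => -[? ->]; case: (clampP y c'0) => -[? ->]; lra.
Qed.

Let invS_le n : 0 <= (n.+1%:R^-1 : R) <= n.+1%:R.
Proof.
apply/andP; split => //; rewrite (@le_trans _ _ 1)//.
  by rewrite invf_le1// ler1n.
by rewrite ler1n.
Qed.

Lemma soft_trunc_lipschitz n x y :
  `|soft_trunc n y - soft_trunc n x| <= `|y - x|.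
Proof.
wlog xy : x y / x <= y.
  move=> h; have [|/ltW] := leP x y; first exact: h.
  by move=> yx; rewrite distrC [leRHS]distrC; exact: h.
have := clampB (invS_le n) xy; rewrite /soft_trunc => /andP[h1 h2].
by rewrite !ger0_norm// subr_ge0.
Qed.

Let clampB0 c c' : 0 <= c <= c' -> clamp c' 0 - clamp c 0 = 0.
Proof.
move=> /andP[c0 cc']; have c'0 := le_trans c0 cc'.
by case: (clampP 0 c0) => -[? ->]; case: (clampP 0 c'0) => -[? ->]; lra.
Qed.

Let clampB_bounded c c' x : 0 <= c <= c' -> `|clamp c' x - clamp c x| <= c'.
Proof.
move=> /andP[c0 cc']; have c'0 := le_trans c0 cc'; rewrite ler_norml.
by case: (clampP x c0) => -[? ->]; case: (clampP x c'0) => -[? ->]; lra.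
Qed.

Let clampB_small c c' x : 0 <= c <= c' -> `|x| < c -> clamp c' x - clamp c x = 0.
Proof.
move=> /andP[c0 cc']; have c'0 := le_trans c0 cc'; rewrite ltr_norml => /andP[? ?].
by case: (clampP x c0) => -[? ->]; case: (clampP x c'0) => -[? ->]; lra.
Qed.

Let clampB_near c c' x : 0 <= c <= c' -> `|x| < c' ->
  `|clamp c' x - clamp c x - x| <= c.
Proof.
move=> /andP[c0 cc']; have c'0 := le_trans c0 cc'.
rewrite ltr_norml ler_norml => /andP[? ?].
by case: (clampP x c0) => -[? ->]; case: (clampP x c'0) => -[? ->]; lra.
Qed.

Lemma soft_trunc0 n : soft_trunc n 0 = 0.
Proof. exact: clampB0 (invS_le n). Qed.

Lemma normr_soft_trunc n x : `|soft_trunc n x| <= `|x|.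
Proof. by have := soft_trunc_lipschitz n 0 x; rewrite soft_trunc0 !subr0. Qed.

Lemma soft_trunc_bounded n x : `|soft_trunc n x| <= n.+1%:R.
Proof. exact: clampB_bounded (invS_le n). Qed.

Lemma soft_trunc_small n x : `|x| < n.+1%:R^-1 -> soft_trunc n x = 0.
Proof. exact: clampB_small (invS_le n). Qed.

(** Once |x| is below the upper cutoff [n.+1], the error is at most the lower cutoff. *)
Lemma soft_trunc_cvg x : soft_trunc n x @[n --> \oo] --> x.
Proof.
apply/subr_cvg0/cvgr0Pnorm_lt => e e0; near=> n.
have xn : `|x| < n.+1%:R.
  near: n; exists (Num.bound `|x|) => //= k kx.
  by rewrite (lt_le_trans (archi_boundP (normr_ge0 x)))// ler_nat ltnW.
have en : n.+1%:R^-1 < e by near: n; exact: (near_infty_natSinv_lt (PosNum e0)).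
exact: le_lt_trans (clampB_near (invS_le n) xn) en.
Unshelve. all: by end_near. Qed.

Lemma measurable_clamp c : measurable_fun setT (clamp c).
Proof. by apply: measurable_maxr => //; exact: measurable_minr. Qed.

Lemma measurable_soft_trunc n : measurable_fun setT (soft_trunc n).
Proof. by apply: measurable_funB; exact: measurable_clamp. Qed.

End truncation.

(** * The s-Laplacian *)
Section square_integrable.
Context d (X : measurableType d) (R : realType).
Variable nu : {measure set X -> \bar R}.
Implicit Types u v : X -> R.

Lemma L2P u : L2 nu u <-> measurable_fun setT u /\ rintegrable nu (fun x => u x ^+ 2)%R.
Proof.
split=> -[mu iu]; split => //.
- by apply: rintegrable_ge0 => //; [exact: measurable_funX|move=> x; exact: sqr_ge0].
- by apply: integrable_lty => //; exact: iu.
Qed.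

Lemma L2M u v : L2 nu u -> L2 nu v -> rintegrable nu (fun x => u x * v x)%R.
Proof.
move=> /L2P[mu iu] /L2P[mv iv].
apply: rintegrable_le (rintegrableD iu iv) _ _; first exact: measurable_funM.
move=> x; rewrite ler_norml; apply/andP; split.
  by have := sqr_ge0 (u x + v x); have := sqr_ge0 (u x); have := sqr_ge0 (v x); lra.
by have := sqr_ge0 (u x - v x); have := sqr_ge0 (u x); have := sqr_ge0 (v x); lra.
Qed.

Lemma L2D u v : L2 nu u -> L2 nu v -> L2 nu (fun x => u x + v x)%R.
Proof.
move=> uL vL; have uv := L2M uL vL; move: uL vL => /L2P[mu iu] /L2P[mv iv].
apply/L2P; split; first exact: measurable_funD.
apply: rintegrable_ext (rintegrableD (rintegrableD iu iv) (rintegrableZ 2 uv)) => x /=.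
by ring.
Qed.

Lemma L2Z k u : L2 nu u -> L2 nu (fun x => k * u x)%R.
Proof.
move=> /L2P[mu iu]; apply/L2P; split; first exact: measurable_funM.
by apply: rintegrable_ext (rintegrableZ (k ^+ 2) iu) => x /=; ring.
Qed.

Lemma L2_ext v u : u =1 v -> L2 nu v -> L2 nu u.
Proof. by move=> uv; have -> : u = v by exact/funext. Qed.

Lemma L2B u v : L2 nu u -> L2 nu v -> L2 nu (fun x => u x - v x)%R.
Proof.
by move=> uL vL; apply: L2_ext (L2D uL (L2Z (-1) vL)) => x /=; ring.
Qed.

(** The single bound by [K * \1_A] encodes both boundedness and a support of finite measure. *)
Definition test_fun (phi : X -> R) := measurable_fun setT phi /\
  exists K A, [/\ measurable A, nu A < +oo, (0 <= K)%R &
    forall x, (`|phi x| <= K * \1_A x)%R].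

Lemma rintegrable_indic A : measurable A -> nu A < +oo ->
  rintegrable nu (\1_A : X -> R).
Proof.
move=> mA nuA; apply: rintegrable_ge0 => //.
by rewrite integral_indic// setIT.
Qed.

Lemma test_fun_L2 phi : test_fun phi -> L2 nu phi.
Proof.
move=> [mphi [K [A [mA nuA K0 phiA]]]]; apply/L2P; split => //.
apply: rintegrable_le (rintegrableZ (K ^+ 2) (rintegrable_indic mA nuA)) _ _.
  exact: measurable_funX.
move=> x; rewrite normrX; have := phiA x; rewrite indicE.
case: (x \in A); rewrite /= ?mulr1 ?mulr0 => h.
  by rewrite ler_sqr ?nnegrE.
by rewrite (_ : `|phi x|%R = 0%R) ?expr0n//; apply/eqP; rewrite eq_le h normr_ge0.
Qed.

Lemma test_funZ k phi : test_fun phi -> test_fun (fun x => k * phi x)%R.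
Proof.
move=> [mphi [K [A [mA nuA K0 phiA]]]]; split; first exact: measurable_funM.
exists (`|k| * K)%R, A; split => //; first by rewrite mulr_ge0.
by move=> x; rewrite normrM -mulrA ler_wpM2l.
Qed.

(** By Chebyshev's inequality the set where |u| >= e, written through u^2, has finite measure; p(u)
    vanishes off it. *)
Lemma L2_comp_test_fun (p : R -> R) (C e : R) u : measurable_fun setT p ->
  (forall r, `|p r| <= C)%R -> (0 < e)%R -> (forall r, `|r| < e -> p r = 0)%R ->
  L2 nu u -> test_fun (fun x => p (u x)).
Proof.
move=> mp pC e0 pe [mu ui]; split; first exact: measurableT_comp.
have e20 : (0 < e ^+ 2)%R by rewrite exprn_gt0.
have mu2 : measurable_fun setT (fun x => (u x ^+ 2)%:E).
  by apply/measurable_EFinP; exact: measurable_funX.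
have mA : measurable [set x | (e ^+ 2)%:E <= `|(u x ^+ 2)%:E|].
  rewrite -[X in measurable X]setTI; apply: emeasurable_fun_c_infty => //.
  exact: measurableT_comp.
exists C, [set x | (e ^+ 2)%:E <= `|(u x ^+ 2)%:E|]; split => //.
- have := le_integral_abse nu measurableT mu2 e20; rewrite setTI.
  have -> : \int[nu]_x `|(u x ^+ 2)%:E| = \int[nu]_x (u x ^+ 2)%:E.
    by apply: eq_integral => x _; rewrite gee0_abs// lee_fin sqr_ge0.
  move=> h; have {h} := le_lt_trans h ui.
  case: (nu _) => [r _||//]; first exact: ltry.
  by rewrite gt0_muley ?lte_fin.
- by rewrite (le_trans _ (pC 0%R)).
- move=> x; rewrite indicE; case: (boolP (x \in _)) => [_|]; rewrite ?mulr1 ?mulr0//.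
  rewrite notin_setE/= lee_fin => /negP; rewrite -ltNge => h.
  rewrite pe ?normr0// -(@ltr_pXn2r _ 2)// ?nnegrE ?(ltW e0)//.
  by rewrite -normrX.
Qed.

Lemma soft_trunc_test_fun n u : L2 nu u -> test_fun (fun x => soft_trunc n (u x)).
Proof.
apply: (L2_comp_test_fun (C := n.+1%:R) (e := n.+1%:R^-1)) => //.
- exact: measurable_soft_trunc.
- by move=> r; exact: soft_trunc_bounded.
- by move=> r; exact: soft_trunc_small.
Qed.

End square_integrable.

(** * Finite energy and Green's formula for the s-Laplacian *)

Section laplacian.
Context d (X : measurableType d) (R : realType).
Variables (m : R.-pker X ~> X) (nu : {measure set X -> \bar R}) (s : R).
Hypothesis rev : reversible m nu.
Hypothesis s1 : (1 < s)%R.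
Local Notation E := (edge m nu).
Implicit Types u v w f : X -> R.

Let s0 : (0 < s)%R. Proof. exact: lt_trans ltr01 s1. Qed.

Lemma measurable_nabla u : measurable_fun setT u -> measurable_fun setT (nabla u).
Proof.
move=> mu; apply: measurable_funB.
- exact: (measurableT_comp mu measurable_snd).
- exact: (measurableT_comp mu measurable_fst).
Qed.

Lemma measurable_nabla_powR u : measurable_fun setT u ->
  measurable_fun setT (fun z => `|nabla u z| `^ s)%R.
Proof.
move=> mu; apply: (measurableT_comp (@measurable_powR R s)).
by apply: measurableT_comp => //; exact: measurable_nabla.
Qed.

Lemma measurable_phi_nabla u : measurable_fun setT u ->
  measurable_fun setT (fun z => phi s (nabla u z)).
Proof.
by move=> mu; apply: (measurableT_comp (measurable_phi s)); exact: measurable_nabla.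
Qed.

Definition fin_energy u := rintegrable E (fun z => `|nabla u z| `^ s)%R.

Lemma integral_energy u : measurable_fun setT u ->
  \int[E]_z (`|nabla u z| `^ s)%:E = \int[nu]_x \int[m x]_y (`|nabla u (x, y)| `^ s)%:E.
Proof.
move=> mu; rewrite ge0_integral_edge//.
by apply/measurable_EFinP; exact: measurable_nabla_powR.
Qed.

Lemma fin_energyP u : measurable_fun setT u ->
  (\int[nu]_x \int[m x]_y (`|nabla u (x, y)| `^ s)%:E < +oo) <-> fin_energy u.
Proof.
move=> mu; rewrite -integral_energy//; split => [h|h].
- apply: rintegrable_ge0 h; first exact: measurable_nabla_powR.
  by move=> z; exact: powR_ge0.
- by apply: integrable_lty => //; exact: h.
Qed.

(** The first marginal of [E] is [nu], because each [m x] is a probability; by reversibility so is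
    the second. *)
Lemma rintegrable_edge_fst f : rintegrable nu f -> rintegrable E (fun z => f z.1).
Proof.
move=> fi; have mf := rintegrable_measurable fi.
have mf1 : measurable_fun setT (fun z : X * X => f z.1).
  exact: (measurableT_comp mf measurable_fst).
apply/integrableP; split; first exact/measurable_EFinP.
rewrite ge0_integral_edge//; last first.
  by apply: measurableT_comp => //; exact/measurable_EFinP.
rewrite (eq_integral (fun x => `|(f x)%:E|)); first by case/integrableP : fi.
move=> x _; rewrite -[LHS]/(\int[m x]_y cst `|(f x)%:E| y) integral_cst//.
by rewrite prob_kernel mule1.
Qed.

Lemma rintegrable_edge_snd f : rintegrable nu f -> rintegrable E (fun z => f z.2).
Proof. by move=> fi; have [] := rintegrable_edge_swap rev (rintegrable_edge_fst fi). Qed.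

Lemma fin_energy_powR u : measurable_fun setT u ->
  rintegrable nu (fun x => `|u x| `^ s)%R -> fin_energy u.
Proof.
move=> mu ui.
have b := rintegrableZ (2 `^ s)%R
  (rintegrableD (rintegrable_edge_snd ui) (rintegrable_edge_fst ui)).
apply: rintegrable_le b _ _; first exact: measurable_nabla_powR.
move=> z; rewrite ger0_norm ?powR_ge0//.
have := normrD_powR_le (u z.2) (- u z.1) (ltW s0).
by rewrite normrN.
Qed.

Lemma test_fun_energy f : test_fun nu f -> fin_energy f.
Proof.
move=> [mf [K [A [mA nuA K0 fA]]]]; apply: fin_energy_powR => //.
apply: rintegrable_le (rintegrableZ (K `^ s)%R (rintegrable_indic mA nuA)) _ _.
  apply: (measurableT_comp (@measurable_powR R s)).
  exact: measurableT_comp.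
move=> x; rewrite ger0_norm ?powR_ge0//; have := fA x; rewrite indicE.
case: (x \in A); rewrite /= ?mulr1 ?mulr0 => h.
  by rewrite ge0_ler_powR ?nnegrE// ltW.
rewrite (_ : `|f x|%R = 0%R) ?powR0 ?gt_eqF//.
by apply/eqP; rewrite eq_le h normr_ge0.
Qed.

Lemma fin_energyD u v : measurable_fun setT u -> measurable_fun setT v ->
  fin_energy u -> fin_energy v -> fin_energy (fun x => u x + v x)%R.
Proof.
move=> mu mv ui vi.
apply: rintegrable_le (rintegrableZ (2 `^ s)%R (rintegrableD ui vi)) _ _.
  by apply: measurable_nabla_powR; exact: measurable_funD.
move=> z; rewrite ger0_norm ?powR_ge0//.
have := normrD_powR_le (nabla u z) (nabla v z) (ltW s0); congr (_ <= _)%R.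
by congr (`|_| `^ _)%R; rewrite /nabla; ring.
Qed.

Lemma fin_energyZ k u : measurable_fun setT u -> fin_energy u ->
  fin_energy (fun x => k * u x)%R.
Proof.
move=> mu ui; apply: rintegrable_ext (rintegrableZ (`|k| `^ s)%R ui) => z.
by rewrite -powRM// -normrM /nabla mulrBr.
Qed.

Lemma phi_nablaM_integrable u v : measurable_fun setT u -> measurable_fun setT v ->
  fin_energy u -> fin_energy v -> rintegrable E (fun z => phi s (nabla u z) * nabla v z)%R.
Proof.
move=> mu mv ui vi; apply: rintegrable_le (rintegrableD ui vi) _ _.
  by apply: measurable_funM; [exact: measurable_phi_nabla|exact: measurable_nabla].
by move=> z; exact: normr_phiM_le.
Qed.

(** The integrability required by [edge_green]: |\nabla u|^(s-1) <= 1 + |\nabla u|^s, where the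
    constant 1 is integrable against the support of [f]. *)
Lemma phi_test_fun_integrable u f : measurable_fun setT u ->
  fin_energy u -> test_fun nu f ->
  rintegrable E (fun z => phi s (nabla u z) * f z.1)%R.
Proof.
move=> mu ui [mf [K [A [mA nuA K0 fA]]]].
have b := rintegrableD (rintegrableZ K (rintegrable_edge_fst (rintegrable_indic mA nuA)))
  (rintegrableZ K ui).
apply: rintegrable_le b _ _.
  apply: measurable_funM; first exact: measurable_phi_nabla.
  exact: (measurableT_comp mf measurable_fst).
move=> z; rewrite normrM normr_phi//.
have h1 := powRB1_le1 s1 (normr_ge0 (nabla u z)).
have h2 := powR_ge0 `|nabla u z| s.
apply: (@le_trans _ _ ((1 + `|nabla u z| `^ s) * (K * \1_A z.1))%R).
  by rewrite ler_pM// powR_ge0.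
have h3 := mulr_ge0 K0 h2.
by rewrite indicE; case: (z.1 \in A); rewrite /= ?mulr1 ?mulr0; lra.
Qed.

(** Fubini gives the first integrability; the second follows from |\nabla u|^(s-1) <= 1 + |\nabla
    u|^s, as constants are integrable for the probability [m x]. *)
Lemma laplacian_ae_fin u : measurable_fun setT u -> fin_energy u ->
  {ae nu, forall x, (m x).-integrable setT (fun y => (`|nabla u (x, y)| `^ s)%:E) /\
    (m x).-integrable setT (fun y => (phi s (nabla u (x, y)))%:E)}.
Proof.
move=> mu ui; have [gi _] := integrable_edge ui.
apply: filterS (integrable_ae measurableT gi) => x /(_ I) gx.
have m1 : measurable_fun setT (fun y => `|nabla u (x, y)| `^ s)%R.
  exact: (measurableT_comp (measurable_nabla_powR mu)).
have i1 : rintegrable (m x) (fun y => `|nabla u (x, y)| `^ s)%R.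
  apply: rintegrable_ge0 => //.
  by rewrite ltey_eq gx.
split; first exact: i1.
have c1 : rintegrable (m x) (cst 1%R).
  apply: rintegrable_ge0 => //.
  rewrite -[X in X < _]/(\int[m x]_y cst 1 y) integral_cst//.
  by rewrite prob_kernel mule1 ltry.
apply: rintegrable_le (rintegrableD c1 i1) _ _.
  exact: (measurableT_comp (measurable_phi_nabla mu)).
by move=> y; rewrite normr_phi//; exact: powRB1_le1.
Qed.

Lemma green_test_fun u w f : measurable_fun setT u -> fin_energy u ->
  measurable_fun setT w ->
  {ae nu, forall x, (w x)%:E = \int[m x]_y (phi s (nabla u (x, y)))%:E} ->
  test_fun nu f ->
  rintegrable nu (fun x => w x * f x)%R /\
  (\int[E]_z (phi s (nabla u z) * nabla f z) = - 2 * \int[nu]_x (w x * f x))%R.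
Proof.
move=> mu ui mw wE tf.
have [|_ ? ?//] := edge_green rev (measurable_phi_nabla mu) _ mw (proj1 tf) wE
  (phi_test_fun_integrable mu ui tf).
by move=> z; rewrite -phiN; congr phi; rewrite /nabla/= opprB.
Qed.

Lemma nabla_lipschitz (p : R -> R) f z :
  (forall x y, `|p y - p x| <= `|y - x|)%R ->
  (`|nabla (fun x => p (f x)) z| <= `|nabla f z|)%R.
Proof. by move=> pl; exact: pl. Qed.

Lemma green_L2 u w f : measurable_fun setT u -> fin_energy u -> L2 nu w ->
  {ae nu, forall x, (w x)%:E = \int[m x]_y (phi s (nabla u (x, y)))%:E} ->
  L2 nu f -> fin_energy f ->
  (\int[E]_z (phi s (nabla u z) * nabla f z) = - 2 * \int[nu]_x (w x * f x))%R.
Proof.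
move=> mu ui wL wE fL fi; have [mf _] := fL; have [mw _] := wL.
pose f_ n x := soft_trunc n (f x).
have tf n : test_fun nu (f_ n) by exact: soft_trunc_test_fun.
have [_ c1] : rintegrable E (fun z => phi s (nabla u z) * nabla f z)%R /\
    (\int[E]_z (phi s (nabla u z) * nabla (f_ n) z))%R @[n --> \oo] -->
    (\int[E]_z (phi s (nabla u z) * nabla f z))%R.
  apply: (rintegral_dominated_cvg _ _ (rintegrableD ui fi)).
  - move=> n; apply: measurable_funM; first exact: measurable_phi_nabla.
    by apply: measurable_nabla; exact: (proj1 (tf n)).
  - move=> z; apply: cvgM; first exact: cvg_cst.
    by apply: cvgB; exact: soft_trunc_cvg.
  (* Truncation is 1-Lipschitz, so it does not increase |\nabla f|, and Young's inequality gives a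
     bound independent of [n]. *)
  - move=> n z; apply: le_trans (normr_phiM_le _ _ s1) _.
    rewrite lerD2l ge0_ler_powR ?nnegrE ?(ltW s0)//.
    by apply: nabla_lipschitz => *; exact: soft_trunc_lipschitz.
have wf := L2M wL fL.
have [_ c2] : rintegrable nu (fun x => w x * f x)%R /\
    (\int[nu]_x (w x * f_ n x))%R @[n --> \oo] --> (\int[nu]_x (w x * f x))%R.
  apply: (rintegral_dominated_cvg _ _ (integrable_norm wf)).
  - by move=> n; apply: measurable_funM => //; exact: (proj1 (tf n)).
  - by move=> x; apply: cvgM; [exact: cvg_cst|exact: soft_trunc_cvg].
  - by move=> n x /=; rewrite !normrM ler_wpM2l// normr_soft_trunc.
have e n : (\int[E]_z (phi s (nabla u z) * nabla (f_ n) z) =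
    - 2 * \int[nu]_x (w x * f_ n x))%R.
  by have [] := green_test_fun mu ui mw wE (tf n).
rewrite (funext e) in c1.
apply: cvg_unique c1 _ => //.
by apply: cvgM => //; exact: cvg_cst.
Qed.

Lemma energy_subgradient u v : measurable_fun setT u -> measurable_fun setT v ->
  fin_energy u -> fin_energy v ->
  (\int[E]_z (`|nabla u z| `^ s) +
   s * \int[E]_z (phi s (nabla u z) * nabla (fun x => v x - u x) z) <=
   \int[E]_z (`|nabla v z| `^ s))%R.
Proof.
move=> mu mv ui vi.
have mN := measurable_funM (measurable_cst (-1 : R)%R) mu.
have uvi : fin_energy (fun x => v x - u x)%R.
  apply: rintegrable_ext (fin_energyD mv mN vi (fin_energyZ (-1) mu ui)) => z /=.
  by congr (`|_| `^ _)%R; rewrite /nabla/=; ring.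
have pi := phi_nablaM_integrable mu (measurable_funB mv mu) ui uvi.
rewrite -rintegralZ// -rintegralD//; last exact: rintegrableZ.
apply: rintegral_le => //; first by apply: rintegrableD => //; exact: rintegrableZ.
move=> z; have := powR_subgradient (nabla u z) (nabla v z) s1.
congr (_ + _ * (_ * _) <= _)%R; rewrite /nabla; ring.
Qed.

End laplacian.

(** * Approximation of convex functions *)
Section affine_minorants.
Context {R : realType}.

Section right_half_line.
Variable j : R -> \bar R.
Hypotheses (jc : convex_ext j) (jl : lower_semicontinuous j).
Hypotheses (j0 : forall r, 0 <= j r) (j00 : j 0%R = 0).

(** The comparison of successive chord slopes, cleared of denominators; [r] is the convex
    combination of [s] and [t] with weight (t - r)/(t - s) on [s]. *)
Let convex_chord (s r t S r' T : R) : (s < r)%R -> (r < t)%R ->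
  j s = S%:E -> j r = r'%:E -> j t = T%:E ->
  ((t - r) * (r' - S) <= (r - s) * (T - r'))%R.
Proof.
move=> sr rt js jr jt; have ts : (0 < t - s)%R by lra.
have := @jc s t ((t - r) / (t - s))%R.
have -> : ((t - r) / (t - s) * s + (1 - (t - r) / (t - s)) * t = r)%R.
  by field; rewrite gt_eqF.
rewrite js jr jt => h.
have {h} : (r'%:E <= ((t - r) / (t - s))%:E * S%:E + (1 - (t - r) / (t - s))%:E * T%:E).
  by apply: h; rewrite divr_ge0 ?ler_pdivrMr//=; lra.
rewrite -!EFinM -EFinD lee_fin => /(ler_wpM2l (ltW ts)).
have -> : ((t - s) * ((t - r) / (t - s) * S + (1 - (t - r) / (t - s)) * T) =
  (t - r) * S + (r - s) * T)%R by field; rewrite gt_eqF.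
by lra.
Qed.

(** Convexity between 0 and [t] with [j 0 = 0] gives j(r) <= (r/t) j(t). *)
Let finite_below (r t : R) : (0 < r)%R -> (r <= t)%R -> j t < +oo -> j r < +oo.
Proof.
move=> r0 rt jt; have t0 : (0 < t)%R by lra.
have := @jc t 0%R (r / t)%R; rewrite mulr0 addr0 divfK ?gt_eqF// j00 mule0 adde0 => h.
apply: le_lt_trans (h _) _; first by rewrite divr_ge0 ?ler_pdivrMr ?mul1r//= ltW.
move: (j0 t) jt; case: (j t) => [T||]// _ _; exact: ltry.
Qed.

(** A supporting line at [x] itself may fail to exist, for instance at the end of the domain of [j].
    It is taken at a point [r1] left of [x], where [j] still exceeds [M] by lower semicontinuity. *)
Lemma affine_minorant_pos (x M : R) : (0 < x)%R -> (0 <= M)%R -> M%:E < j x ->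
  exists a b : R, [/\ (0 <= a)%R, (0 <= b)%R, (M < a * x - b)%R &
    forall r, (a * r - b)%:E <= j r].
Proof.
move=> x0 M0 Mx; have [V [/= d d0 dV] MV] := jl Mx.
pose e := Num.min d x; have e0 : (0 < e)%R by rewrite lt_min d0.
have ex : (e <= x)%R by rewrite ge_min lexx orbT.
have ed : (e <= d)%R by rewrite ge_min lexx.
pose r1 := (x - e / 2)%R; pose r2 := (x - e / 4)%R.
have r10 : (0 < r1)%R by rewrite /r1; lra.
have r12 : (r1 < r2)%R by rewrite /r1 /r2; lra.
have r2x : (r2 < x)%R by rewrite /r2; lra.
have Mr1 : M%:E < j r1.
  by apply/MV/dV; rewrite /ball_/= /r1 opprB addrC subrK ger0_norm; lra.
have [jr2|jr2] := eqVneq (j r2) +oo.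
  (* Here [j] is infinite from [r2] on, so the line through 0 at [r2] and [M + 1] at [x] lies below
     it. *)
  exists ((M + 1) / (x - r2))%R, ((M + 1) / (x - r2) * r2)%R.
  have c0 : (0 <= (M + 1) / (x - r2))%R by rewrite divr_ge0; lra.
  split => //.
  - by rewrite mulr_ge0//; lra.
  - rewrite -mulrBr divfK ?gt_eqF ?subr_gt0//; lra.
  - move=> r; have [rr2|r2r] := leP r r2.
      apply: le_trans (j0 r); rewrite lee_fin -mulrBr mulr_ge0_le0// subr_le0//.
    have [->|jr] := eqVneq (j r) +oo; first exact: leey.
    have : j r2 < +oo by apply: (@finite_below r2 r); [lra|lra|rewrite ltey].
    by rewrite jr2.
have jr2y : j r2 < +oo by rewrite ltey.
have jr1y : j r1 < +oo by apply: (finite_below r10 (ltW r12)).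
have fin r : j r < +oo -> exists r', j r = r'%:E.
  by move: (j0 r); case: (j r) => [r'||]// _ _; exists r'.
have [f1 jr1] := fin _ jr1y; have [f2 jr2'] := fin _ jr2y.
have f10 : (0 <= f1)%R by rewrite -lee_fin -jr1.
(* Slopes of the chords from [r1] to the right: [inf S] is the right derivative of [j] at [r1].
   Chords to the left of [r1] give lower bounds of [S], and finiteness at [r2] makes [S]
   nonempty. *)
pose S := [set v | exists t T,
  [/\ (r1 < t)%R, j t = T%:E & v = ((T - f1) / (t - r1))%R]].
have Slb s v : (s < r1)%R -> j s = v%:E -> lbound S ((f1 - v) / (r1 - s))%R.
  move=> sr1 js _ [t [T [r1t jt ->]]].
  rewrite ler_pdivlMr ?subr_gt0// mulrAC ler_pdivrMr ?subr_gt0// mulrC [leRHS]mulrC.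
  exact: (convex_chord sr1 r1t js jr1 jt).
have S2 : S ((f2 - f1) / (r2 - r1))%R by exists r2, f2.
have Sinf : has_inf S.
  split; first by exists ((f2 - f1) / (r2 - r1))%R.
  by exists ((f1 - 0) / (r1 - 0))%R; exact: Slb.
have infge s v : (s < r1)%R -> j s = v%:E -> (f1 - v <= inf S * (r1 - s))%R.
  move=> sr1 js; rewrite -ler_pdivrMr ?subr_gt0//.
  by apply: lb_le_inf; [exact: (proj1 Sinf)|exact: Slb].
(* The chord from the origin yields both signs: [inf S] is nonnegative and the line is at most 0 at
   the origin. *)
have inf0 := infge 0%R 0%R r10 j00; rewrite !subr0 in inf0.
have infp : (0 <= inf S)%R.
  by rewrite -(pmulr_lge0 _ r10); exact: le_trans inf0.
exists (inf S), (inf S * r1 - f1)%R; split => //.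
- by rewrite subr_ge0.
- have : (0 <= inf S * (x - r1))%R by rewrite mulr_ge0//; lra.
  by move: Mr1; rewrite jr1 lte_fin; lra.
- move=> r; have [jr|] := eqVneq (j r) +oo; first by rewrite jr leey.
  rewrite -ltey => /fin[T jr]; rewrite jr lee_fin.
  have [rr1|r1r|rr1] := ltgtP r r1.
  + by have := infge r T rr1 jr; lra.
  + have : (inf S <= (T - f1) / (r - r1))%R.
      by apply: ge_inf; [exact: (proj2 Sinf)|exists r, T].
    by rewrite ler_pdivlMr ?subr_gt0//; lra.
  + by move: jr; rewrite rr1 jr1 => -[<-]; lra.
Qed.

(** With gap [g] at [x], the slope is lowered by less than g/(2x) and [b] raised by less than g/2,
    so the line still exceeds [M] at [x]. It stays a minorant for r >= 0 by monotonicity, and for r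
    < 0 because it is negative there. Strict positivity of [b] makes it negative near 0. *)
Lemma rat_minorant_pos (x M : R) : (0 < x)%R -> (0 <= M)%R -> M%:E < j x ->
  exists a b : rat, [/\ (0 < ratr b :> R)%R, (M < ratr a * x - ratr b)%R &
    forall r, (ratr a * r - ratr b)%:E <= j r].
Proof.
move=> x0 M0 Mx; have [a [b [a0 b0 Mab abj]]] := affine_minorant_pos x0 M0 Mx.
have a1 : (0 < a)%R.
  rewrite lt_neqAle a0 andbT eq_sym; apply/eqP => a0'; move: Mab; rewrite a0'; lra.
pose g := (a * x - b - M)%R; have g0 : (0 < g)%R by rewrite /g; lra.
have : (Num.max 0 (a - g / (2 * x)) < a)%R.
  by rewrite gt_max a1/= gtrBl divr_gt0// mulr_gt0.
move=> /rat_in_itvoo[a']; rewrite in_itv/= gt_max => /andP[/andP[a'0 a'l] a'a].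
have : (b < b + g / 2)%R by lra.
move=> /rat_in_itvoo[b']; rewrite in_itv/= => /andP[bb' b'b].
exists a', b'; split; first by lra.
- have : ((a - g / (2 * x)) * x <= ratr a' * x)%R by rewrite ler_wpM2r ?ltW.
  have -> : ((a - g / (2 * x)) * x = a * x - g / 2)%R by field; rewrite gt_eqF.
  by rewrite /g in b'b *; lra.
- move=> r; have [r0|r0] := leP 0%R r.
    apply: le_trans (abj r); rewrite lee_fin.
    have : (ratr a' * r <= a * r)%R by rewrite ler_wpM2r// ltW.
    by lra.
  apply: le_trans (j0 r); rewrite lee_fin.
  have : (ratr a' * r <= 0)%R by rewrite mulr_ge0_le0// ltW.
  by lra.
Qed.

End right_half_line.

(** Negative [x] reduces to positive [x] by reflecting [j]; x = 0 is excluded by [j 0 = 0]. *)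
Lemma rat_minorant (j : R -> \bar R) (x M : R) :
  convex_ext j -> lower_semicontinuous j -> (forall r, 0 <= j r) -> j 0%R = 0 ->
  (0 <= M)%R -> M%:E < j x ->
  exists a b : rat, [/\ (0 < ratr b :> R)%R, (M < ratr a * x - ratr b)%R &
    forall r, (ratr a * r - ratr b)%:E <= j r].
Proof.
move=> jc jl j0 j00 M0 Mx; have [x0|x0|x0] := ltgtP x 0%R; last first.
- by move: Mx; rewrite x0 j00 lte_fin ltNge M0.
- exact: rat_minorant_pos.
pose k r := j (- r)%R.
have [|||||||a [b [b0 Mab abj]]] := @rat_minorant_pos k _ _ _ _ (- x)%R M.
- move=> r t l /jc h; rewrite /k; have := h (- r)%R (- t)%R.
  by congr (j _ <= _); ring.
- move=> r y; rewrite /k => /jl[V Vr Vj]; exists (fun t => V (- t)%R) => [|t Vt].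
    exact: (opp_continuous r).
  exact: Vj.
- by move=> r; exact: j0.
- by rewrite /k oppr0.
- by rewrite oppr_gt0.
- exact: M0.
- by rewrite /k opprK.
exists (- a)%R, b; split => //.
- by rewrite rmorphN/= mulNr -mulrN.
- by move=> r; have := abj (- r)%R; rewrite /k opprK mulrN rmorphN/= mulNr.
Qed.

(* p is a selection of the subdifferential of the convex function g; both vanish
   near 0. *)
Definition slope_pair (g p : R -> R) :=
  [/\ measurable_fun setT g, measurable_fun setT p, (forall r, 0 <= g r)%R,
      (forall r t, g r + p r * (t - r) <= g t)%R &
      exists C e, [/\ (0 < e)%R, (forall r, `|p r| <= C)%R &
        (forall r, `|r| < e -> p r = 0 /\ g r = 0)%R]].

Lemma slope_pair0 : slope_pair (cst 0%R) (cst 0%R).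
Proof.
split => //=; first by move=> r t; rewrite mul0r addr0.
by exists 0%R, 1%R; split => // r; rewrite normr0.
Qed.

Lemma slope_pair_max (g p : R -> R) (a b : R) : slope_pair g p -> (0 < b)%R ->
  slope_pair (fun r => Num.max (g r) (a * r - b))%R
             (fun r => if (a * r - b <= g r)%R then p r else a).
Proof.
move=> [mg mp g0 gp [C [e [e0 pC pe]]]] b0.
have ml : measurable_fun setT (fun r => a * r - b)%R.
  by apply: measurable_funB => //; exact: measurable_funM.
split.
- exact: measurable_maxr.
- by apply: measurable_fun_ifT => //; exact: measurable_fun_ler.
- by move=> r; rewrite le_max g0.
- move=> r t; rewrite le_max; have [ag|ga] := leP (a * r - b)%R (g r).
    by rewrite gp.
  by apply/orP; right; lra.
- have a1 : (0 < `|a| + 1)%R by have := normr_ge0 a; lra.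
  (* For |r| < b/(|a| + 1) the new line is at most 0, so [g] and its slope are unchanged near 0; the
     [+ 1] covers a = 0. *)
  exists (C + `|a|)%R, (Num.min e (b / (`|a| + 1)))%R; split.
  + by rewrite lt_min e0 divr_gt0.
  + move=> r; case: ifP => _; last by rewrite lerDr (le_trans _ (pC 0%R)).
    by rewrite (le_trans (pC r))// lerDl.
  + move=> r; rewrite lt_min ltr_pdivlMr// => /andP[re rb].
    have arb : (a * r - b <= 0)%R.
      rewrite subr_le0 (le_trans (ler_norm _))// normrM.
      by rewrite (le_trans _ (ltW rb))// mulrC ler_wpM2l// lerDl.
    have [pr gr] := pe r re.
    by rewrite pr gr arb; split => //; apply/max_idPl.
Qed.

Section approximation.
Variable j : R -> \bar R.
Hypotheses (jc : convex_ext j) (jl : lower_semicontinuous j).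
Hypotheses (j0 : forall r, 0 <= j r) (j00 : j 0%R = 0).

Let minorant (ab : rat * rat) := (0 < ratr ab.2 :> R)%R /\
  forall r, (ratr ab.1 * r - ratr ab.2)%:E <= j r.

(** Runs through all pairs of rationals by their codes and adjoins those that are minorants with
    [b > 0]. The maximum and its slope selection are built together, since the selection depends on
    which function is active. *)
Fixpoint convex_approx (n : nat) : (R -> R) * (R -> R) :=
  if n is n'.+1 then
    let gp := convex_approx n' in
    if @unpickle (rat * rat)%type n' is Some ab then
      if `[< minorant ab >] then
        (fun r => Num.max (gp.1 r) (ratr ab.1 * r - ratr ab.2),
         fun r => if ratr ab.1 * r - ratr ab.2 <= gp.1 r then gp.2 r else ratr ab.1)%R
      else gp
    else gp
  else (cst 0%R, cst 0%R).

Lemma convex_approx_slope_pair n :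
  slope_pair (convex_approx n).1 (convex_approx n).2.
Proof.
elim: n => [|n ih] /=; first exact: slope_pair0.
case: unpickle => [ab|]//; case: asboolP => [[b0 _]|]//.
exact: slope_pair_max.
Qed.

Lemma convex_approx_le n r : ((convex_approx n).1 r)%:E <= j r.
Proof.
elim: n => [|n ih] //=; case: unpickle => [ab|]//; case: asboolP => [[_ h]|]//=.
by rewrite EFin_max ge_max ih h.
Qed.

Lemma convex_approx_nd r :
  {homo (fun n => ((convex_approx n).1 r)%:E) : m n / (m <= n)%N >-> m <= n}.
Proof.
apply: homo_leq => //; first exact: le_trans.
move=> n /=; case: unpickle => [ab|]//; case: asboolP => [_|_]//=.
by rewrite lee_fin le_max lexx.
Qed.

Let convex_approx_minorant n ab r : unpickle n = Some ab -> minorant ab ->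
  (ratr ab.1 * r - ratr ab.2 <= (convex_approx n.+1).1 r)%R.
Proof. by move=> /= -> abm; case: asboolP => //= _; rewrite le_max lexx orbT. Qed.

(** If the supremum at [r] were below j(r), [rat_minorant] would provide a rational line strictly
    between. That line enters at the stage one after its code, contradicting the supremum. *)
Lemma convex_approx_cvg r : ((convex_approx n).1 r)%:E @[n --> \oo] --> j r.
Proof.
have := ereal_nondecreasing_cvgn (convex_approx_nd r).
rewrite (_ : ereal_sup _ = j r)//; apply/eqP; rewrite eq_le; apply/andP; split.
  by apply: ge_ereal_sup => _ [n _ <-]; exact: convex_approx_le.
have h0 : 0 <= ereal_sup (range (fun n => ((convex_approx n).1 r)%:E)).
  by apply: ereal_sup_ubound; exists 0%N.
rewrite leNgt; apply/negP => h.
have : ereal_sup (range (fun n => ((convex_approx n).1 r)%:E)) \is a fin_num.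
  by rewrite ge0_fin_numE// (lt_le_trans h)// leey.
move=> /fineK Se; rewrite -Se in h h0.
have [a [b [b0 ab abj]]] := rat_minorant jc jl j0 j00 h0 h.
have : ((convex_approx (pickle (a, b)).+1).1 r)%:E <=
    ereal_sup (range (fun n => ((convex_approx n).1 r)%:E)).
  by apply: ereal_sup_ubound; exists (pickle (a, b)).+1.
have abm := @convex_approx_minorant (pickle (a, b)) (a, b) r (pickleK _) (conj b0 abj).
by rewrite -Se lee_fin => /(le_trans abm); rewrite leNgt ab.
Qed.

End approximation.
End affine_minorants.

(** * Estimates for the s-Laplacian *)
Lemma rintegrable_le_ae d (T : measurableType d) (R : realType)
    (nu : {measure set T -> \bar R}) (g f : T -> R) :
  rintegrable nu g -> measurable_fun setT f ->
  {ae nu, forall x, `|f x| <= g x}%R -> rintegrable nu f.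
Proof.
move=> gi mf fg; apply/integrableP; split; first exact/measurable_EFinP.
case/integrableP : (gi) => mg; apply: le_lt_trans; apply: ae_ge0_le_integral => //.
- by apply: measurableT_comp => //; exact/measurable_EFinP.
- exact: measurableT_comp.
- by apply: filterS fg => x fgx _ /=; rewrite lee_fin (le_trans fgx)// ler_norm.
Qed.

Section slope_pair_integral.
Context d (X : measurableType d) (R : realType).
Variable nu : {measure set X -> \bar R}.

(** The subgradient inequality between u and 0 gives g(u) <= p(u) u <= C |u|. As g(u) = 0 for |u| <
    e, this is at most (C/e) u^2. *)
Lemma slope_pair_integrable g p (u : X -> R) : slope_pair g p -> L2 nu u ->
  rintegrable nu (fun x => g (u x)).
Proof.
move=> [mg mp g0 gp [C [e [e0 pC pe]]]] /L2P[mu ui].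
have C0 : (0 <= C)%R by exact: le_trans (pC 0%R).
apply: rintegrable_le (rintegrableZ (C / e)%R ui) _ _; first exact: measurableT_comp.
move=> x; rewrite ger0_norm//; have [ue|eu] := ltP `|u x|%R e.
  by rewrite (proj2 (pe _ ue)) mulr_ge0 ?sqr_ge0// divr_ge0// ltW.
have g00 : g 0%R = 0%R by apply: (proj2 (pe 0%R _)); rewrite normr0.
have := gp (u x) 0%R; rewrite g00 sub0r mulrN subr_le0 => /le_trans; apply.
apply: le_trans (ler_norm _) _; rewrite normrM.
apply: (@le_trans _ _ (C * `|u x|)%R); first by rewrite ler_wpM2r.
rewrite -mulrA ler_wpM2l// -(@real_normK _ (u x)) ?num_real// expr2 mulrA.
by rewrite ler_peMl// mulrC ler_pdivlMr// mul1r.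
Qed.

Lemma slope_pair_nondecreasing (g p : R -> R) x y : slope_pair g p ->
  (x <= y)%R -> (p x <= p y)%R.
Proof.
move=> [_ _ _ gp _]; rewrite le_eqVlt => /predU1P[->//|xy].
have h1 := gp x y; have h2 := gp y x.
have : ((p x - p y) * (y - x) <= 0)%R by lra.
by rewrite pmulr_lle0 ?subr_gt0// subr_le0.
Qed.

Lemma slope_pair_test_fun g p (u : X -> R) : slope_pair g p -> L2 nu u ->
  test_fun nu (fun x => p (u x)).
Proof.
move=> [_ mp _ _ [C [e [e0 pC pe]]]].
by apply: (L2_comp_test_fun (C := C) (e := e)) => // r /pe[].
Qed.

End slope_pair_integral.

Section laplacian_estimates.
Context d (X : measurableType d) (R : realType).
Variables (m : R.-pker X ~> X) (nu : {measure set X -> \bar R}) (s : R).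
Hypothesis rev : reversible m nu.
Hypothesis s1 : (1 < s)%R.
Local Notation E := (edge m nu).
Implicit Types u v w f : X -> R.

Let s0 : (0 < s)%R. Proof. exact: lt_trans ltr01 s1. Qed.

Lemma FsmE u : measurable_fun setT u -> fin_energy m nu s u ->
  Fsm s m nu u = ((2 * s)^-1 * \int[E]_z (`|nabla u z| `^ s))%:E.
Proof.
by move=> mu ui; rewrite /Fsm -integral_energy// rintegralE.
Qed.

Lemma Fsm_ge0 u : 0 <= Fsm s m nu u.
Proof.
apply: mule_ge0; first by rewrite lee_fin invr_ge0 mulr_ge0// ltW.
by apply: integral_ge0 => x _; apply: integral_ge0 => y _; rewrite lee_fin powR_ge0.
Qed.

Lemma Fsm_fin_energy u : measurable_fun setT u -> Fsm s m nu u < +oo ->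
  fin_energy m nu s u.
Proof.
move=> mu; rewrite /Fsm => h; apply/fin_energyP => //; move: h.
case: (\int[nu]_x _) => [r _||//]; first exact: ltry.
by rewrite gt0_muley// lte_fin invr_gt0 mulr_gt0.
Qed.

(** A total real-valued version: [fine] gives 0 where the integral is infinite, which for finite
    energy is a null set by [laplacianE]. *)
Definition laplacian u x := fine (\int[m x]_y (phi s (nabla u (x, y)))%:E).

Lemma measurable_laplacian u : measurable_fun setT u ->
  measurable_fun setT (laplacian u).
Proof.
move=> mu; rewrite /laplacian; apply: measurableT_comp => //.
apply: (@measurable_kernel_integral _ _ _ m (fun z => phi s (nabla u z))).
exact: measurable_phi_nabla.
Qed.

Lemma laplacianE u : measurable_fun setT u -> fin_energy m nu s u ->
  {ae nu, forall x, (laplacian u x)%:E = \int[m x]_y (phi s (nabla u (x, y)))%:E}.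
Proof.
move=> mu ui; apply: filterS (laplacian_ae_fin s1 mu ui) => x [_ ix].
by rewrite fineK//; exact: integrable_fin_num.
Qed.

(** The functions G_1 and G_2 of the overview, made real-valued by [fine]. *)
Definition local_energy u x := fine (\int[m x]_y (`|nabla u (x, y)| `^ s)%:E).

Lemma local_energy_ge0 u x : (0 <= local_energy u x)%R.
Proof. by apply: fine_ge0; apply: integral_ge0 => y _; rewrite lee_fin powR_ge0. Qed.

Lemma rintegrable_local_energy u : measurable_fun setT u -> fin_energy m nu s u ->
  rintegrable nu (local_energy u).
Proof.
move=> mu ui; have [gi ge] := integrable_edge ui.
apply: rintegrable_ge0 => [||].
- by apply: measurableT_comp => //; case/integrableP : gi.
- exact: local_energy_ge0.
- have : \int[nu]_x \int[m x]_y (`|nabla u (x, y)| `^ s)%:E < +oo by rewrite ge ltry.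
  apply: le_lt_trans; apply: ge0_le_integral => //.
  + by move=> x _; rewrite lee_fin; exact: local_energy_ge0.
  + by apply/measurable_EFinP; apply: measurableT_comp => //; case/integrableP : gi.
  + by case/integrableP : gi.
  + move=> x _; rewrite /local_energy.
    have : 0 <= \int[m x]_y (`|nabla u (x, y)| `^ s)%:E.
      by apply: integral_ge0 => y _; rewrite lee_fin powR_ge0.
    by case: (\int[m x]_y _) => [r||]//= _; rewrite leey.
Qed.

Lemma rintegrable_pker_cst x (r : R) : rintegrable (m x) (cst r) /\
  (\int[m x]_y (cst r y) = r)%R.
Proof.
have e : \int[m x]_y (cst r y)%:E = r%:E.
  rewrite -[LHS]/(\int[m x]_y cst r%:E y) integral_cst//.
  by rewrite prob_kernel mule1.
split; last by rewrite /Rintegral e.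
apply/integrableP; split; first exact/measurable_EFinP.
by rewrite integral_fin_num_abs// e.
Qed.

(** [powRB1_le] integrated against the probability [m x]. The parameter [e] is quantified inside the
    almost-everywhere statement so that it may depend on [x]. *)
Lemma laplacian_le u : measurable_fun setT u -> fin_energy m nu s u ->
  {ae nu, forall x, forall e : R, (0 < e)%R -> (e `^ (s - 1) <= e)%R ->
    (`|laplacian u x| <= e + e^-1 * local_energy u x)%R}.
Proof.
move=> mu ui; apply: filterS (laplacian_ae_fin s1 mu ui) => x [gx ix] e e0 ee.
have [ci ce] := rintegrable_pker_cst x e.
have gx' : rintegrable (m x) (fun y => `|nabla u (x, y)| `^ s)%R by exact: gx.
rewrite -{1}ce -rintegralZ// -rintegralD//; last exact: rintegrableZ.
apply: le_trans (le_normr_Rintegral measurableT ix) _.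
apply: rintegral_le.
- exact: integrable_norm.
- by apply: rintegrableD => //; exact: rintegrableZ.
- by move=> y /=; rewrite normr_phi//; exact: powRB1_le.
Qed.

(** For |w| > 2 take e = |w|/2 >= 1, admissible because s - 1 <= 1; absorbing |w|/2 on the left
    leaves w^2 <= 4 G. Otherwise w^2 <= 4. *)
Lemma laplacian_sqr_le2 u : (s <= 2)%R -> measurable_fun setT u ->
  fin_energy m nu s u ->
  {ae nu, forall x, (laplacian u x ^+ 2 <= 4 + 4 * local_energy u x)%R}.
Proof.
move=> s2 mu ui; apply: filterS (laplacian_le mu ui) => x h.
have g0 := local_energy_ge0 u x.
rewrite -real_normK ?num_real//; have l0 := normr_ge0 (laplacian u x).
have [l2|l2] := leP `|laplacian u x|%R 2%R; first by nra.
have e1 : (1 <= `|laplacian u x| / 2)%R by lra.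
have := h (`|laplacian u x| / 2)%R.
have -> : ((`|laplacian u x| / 2)^-1 * local_energy u x =
  2 * local_energy u x / `|laplacian u x|)%R by field; rewrite gt_eqF//; lra.
move=> {}h.
have : (`|laplacian u x| / 2 <= 2 * local_energy u x / `|laplacian u x|)%R.
  have : (`|laplacian u x| <= `|laplacian u x| / 2 + 2 * local_energy u x / `|laplacian u x|)%R.
    by apply: h; [lra|apply: ler1_powR => //; lra].
  by lra.
rewrite ler_pdivlMr; last by lra.
by rewrite expr2; lra.
Qed.

(** First e = 1 gives |w| <= 1 + G <= 2. Then e = |w|/2 <= 1 is admissible because s - 1 >= 1, and
    absorption leaves w^2 <= 4 G. *)
Lemma laplacian_sqr_ge2 u : (2 <= s)%R -> measurable_fun setT u ->
  fin_energy m nu s u ->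
  {ae nu, forall x, (local_energy u x <= 1)%R ->
    (laplacian u x ^+ 2 <= 4 * local_energy u x)%R}.
Proof.
move=> s2 mu ui; apply: filterS (laplacian_le mu ui) => x h g1.
have g0 := local_energy_ge0 u x.
rewrite -real_normK ?num_real//.
have [l0|l0] := eqVneq (laplacian u x) 0%R; first by rewrite l0 normr0 expr0n/= mulr_ge0.
have {}l0 : (0 < `|laplacian u x|)%R by rewrite normr_gt0.
have l2 : (`|laplacian u x| <= 2)%R.
  by have := h 1%R ltr01; rewrite powR1 lexx invr1 mul1r => /(_ erefl); lra.
have := h (`|laplacian u x| / 2)%R.
have -> : ((`|laplacian u x| / 2)^-1 * local_energy u x =
  2 * local_energy u x / `|laplacian u x|)%R by field; rewrite gt_eqF.
move=> {}h.
have : (`|laplacian u x| / 2 <= 2 * local_energy u x / `|laplacian u x|)%R.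
  have : (`|laplacian u x| <= `|laplacian u x| / 2 + 2 * local_energy u x / `|laplacian u x|)%R.
    by apply: h; [lra|apply: ge1r_powR; [apply/andP; split|]; lra].
  by lra.
rewrite ler_pdivlMr//.
by rewrite expr2; lra.
Qed.

(** The integrand phi(\nabla u) is bounded by [C] and vanishes unless x or y lies in [A], so it is
    integrable on [E]. One factor of w^2 is bounded by [C], the other by the integral of |phi(\nabla
    u)|. *)
Lemma laplacian_test_fun_L2 u : test_fun nu u -> L2 nu (laplacian u).
Proof.
move=> tu; have [mu [K [A [mA nuA K0 uA]]]] := tu.
have ui := test_fun_energy rev s1 tu.
pose C := ((2 * K) `^ (s - 1))%R.
have C0 : (0 <= C)%R by exact: powR_ge0.
have uK x : (`|u x| <= K)%R.
  by apply: le_trans (uA x) _; rewrite indicE; case: (_ \in _); rewrite ?mulr1 ?mulr0.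
have phiC z : (`|phi s (nabla u z)| <= C)%R.
  rewrite normr_phi// ge0_ler_powR ?nnegrE ?mulr_ge0// ?subr_ge0 ?(ltW s1)//.
  by apply: le_trans (ler_normB _ _) _; have := uK z.1; have := uK z.2; lra.
have ii := rintegrable_indic mA nuA.
have phii : rintegrable E (fun z => `|phi s (nabla u z)|)%R.
  have b := rintegrableZ C (rintegrableD (rintegrable_edge_fst m ii) (rintegrable_edge_snd rev ii)).
  apply: rintegrable_le b _ _.
    by apply: measurableT_comp => //; exact: measurable_phi_nabla.
  move=> z; rewrite normr_id !indicE.
  have out x : x \notin A -> u x = 0%R.
    move=> xA; apply/eqP; rewrite -normr_le0; apply: le_trans (uA x) _.
    by rewrite indicE (negbTE xA) mulr0.
  case: (boolP (z.1 \in A)) => [_|/out z1].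
    apply: le_trans (phiC z) _; rewrite ler_peMr//.
    by case: (_ \in _); rewrite /= ?addr0//; lra.
  case: (boolP (z.2 \in A)) => [_|/out z2]; first by rewrite add0r mulr1.
  by rewrite /nabla z1 z2 subr0 phi0 normr0 addr0 mulr0.
have [hi _] := integrable_edge phii.
apply/L2P; split; first exact: measurable_laplacian.
apply/integrableP; split.
  by apply/measurable_EFinP; apply: measurable_funX; exact: measurable_laplacian.
case/integrableP : (integrableZl measurableT C hi) => mh.
apply: le_lt_trans; apply: ae_ge0_le_integral => //.
- apply: measurableT_comp => //; apply/measurable_EFinP; apply: measurable_funX.
  exact: measurable_laplacian.
- exact: measurableT_comp.
- apply: filterS (laplacian_ae_fin s1 mu ui) => x [_ ix] _.
  have ix' : rintegrable (m x) (fun y => phi s (nabla u (x, y)))%R by exact: ix.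
  have nx : rintegrable (m x) (fun y => `|phi s (nabla u (x, y))|)%R.
    exact: integrable_norm.
  rewrite (rintegralE nx) -EFinM /= lee_fin.
  have h1 : (`|laplacian u x| <= \int[m x]_y `|phi s (nabla u (x, y))|)%R.
    exact: le_normr_Rintegral.
  have h2 : (\int[m x]_y `|phi s (nabla u (x, y))| <= C)%R.
    have [ci ce] := rintegrable_pker_cst x C.
    by rewrite -[leRHS]ce; apply: rintegral_le.
  rewrite normrX; apply: le_trans (ler_norm _).
  by rewrite expr2; apply: ler_pM => //; exact: le_trans h2.
Qed.

(** The integrated gradient inequality followed by Green's formula; the constants 1/(2s), s and - 2
    multiply to - 1. *)
Lemma energy_laplacian u w v : Delta s m nu u w -> L2 nu v -> fin_energy m nu s v ->
  ((2 * s)^-1 * \int[E]_z (`|nabla u z| `^ s) - \int[nu]_x (w x * (v x - u x)) <=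
   (2 * s)^-1 * \int[E]_z (`|nabla v z| `^ s))%R.
Proof.
move=> [uL wL ui wE] vL vi; have [mu _] := uL; have [mv _] := vL.
move/fin_energyP : ui => /(_ mu) ui.
have vuL := L2B vL uL.
have mN := measurable_funM (measurable_cst (-1 : R)%R) mu.
have vui : fin_energy m nu s (fun x => v x - u x)%R.
  apply: rintegrable_ext (fin_energyD s1 mv mN vi (fin_energyZ (-1) mu ui)) => z /=.
  by congr (`|_| `^ _)%R; rewrite /nabla/=; ring.
have := energy_subgradient s1 mu mv ui vi.
rewrite (green_L2 rev s1 mu ui wL wE vuL vui).
have s2 : (0 <= (2 * s)^-1)%R by rewrite invr_ge0 mulr_ge0// ltW.
move=> /(ler_wpM2l s2); congr (_ <= _)%R; field; by rewrite gt_eqF.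
Qed.

(** The gradient inequality is taken at the perturbed function, so that it bounds the perturbed
    energy from above. This replaces differentiating the energy. *)
Lemma energy_directional u f (t : R) : measurable_fun setT u ->
  fin_energy m nu s u -> test_fun nu f ->
  fin_energy m nu s (fun x => u x + t * f x)%R /\
  ((2 * s)^-1 * \int[E]_z (`|nabla (fun x => u x + t * f x) z| `^ s) <=
   (2 * s)^-1 * \int[E]_z (`|nabla u z| `^ s) +
   t / 2 * \int[E]_z (phi s (nabla (fun x => u x + t * f x) z) * nabla f z))%R.
Proof.
move=> mu ui tf; have [mf _] := tf; have fi := test_fun_energy rev s1 tf.
have mtf : measurable_fun setT (fun x => t * f x)%R by exact: measurable_funM.
have mutf : measurable_fun setT (fun x => u x + t * f x)%R by exact: measurable_funD.
have utfi := fin_energyD s1 mu mtf ui (fin_energyZ t mf fi).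
split => //; have := energy_subgradient s1 mutf mu utfi ui.
have -> : (\int[E]_z (phi s (nabla (fun x => u x + t * f x) z) *
    nabla (fun x => u x - (u x + t * f x)) z) =
    - t * \int[E]_z (phi s (nabla (fun x => u x + t * f x) z) * nabla f z))%R.
  rewrite -rintegralZ; last exact: phi_nablaM_integrable.
  by apply: rintegral_ext => z; rewrite /nabla; ring.
have s2 : (0 <= (2 * s)^-1)%R by rewrite invr_ge0 mulr_ge0// ltW.
move=> /(ler_wpM2l s2).
set I := (\int[E]_z (phi s (nabla (fun x => u x + t * f x) z) * nabla f z))%R.
have -> : ((2 * s)^-1 * (\int[E]_z `|nabla (fun x => u x + t * f x) z| `^ s +
    s * (- t * I)) = (2 * s)^-1 * \int[E]_z `|nabla (fun x => u x + t * f x) z| `^ s -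
    t / 2 * I)%R by field; rewrite gt_eqF.
by rewrite lerBlDr.
Qed.

Lemma phi_nabla_cvg u f : measurable_fun setT u ->
  fin_energy m nu s u -> test_fun nu f ->
  (\int[E]_z (phi s (nabla (fun x => u x + n.+1%:R^-1 * f x) z) * nabla f z))%R
    @[n --> \oo] --> (\int[E]_z (phi s (nabla u z) * nabla f z))%R.
Proof.
move=> mu ui tf; have [mf _] := tf; have fi := test_fun_energy rev s1 tf.
have nE (t : R) z : (nabla (fun x => u x + t * f x) z = nabla u z + t * nabla f z)%R.
  by rewrite /nabla; ring.
have b := rintegrableD (rintegrableZ (2 `^ s)%R (rintegrableD ui fi)) fi.
apply: (proj2 (rintegral_dominated_cvg _ _ b _)).
- move=> n; apply: measurable_funM; last exact: measurable_nabla.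
  by apply: measurable_phi_nabla; apply: measurable_funD => //; exact: measurable_funM.
- move=> z; apply: cvgM; last exact: cvg_cst.
  under eq_fun do rewrite nE.
  apply: (@cvg_comp _ _ _ (fun n => nabla u z + n.+1%:R^-1 * nabla f z)%R (phi s)
    _ (nbhs (nabla u z))); last exact: continuous_phi.
  have : (nabla u z + n.+1%:R^-1 * nabla f z)%R @[n --> \oo] -->
      (nabla u z + 0 * nabla f z)%R.
    apply: cvgD; first exact: cvg_cst.
    by apply: cvgM; [exact: cvg_harmonic|exact: cvg_cst].
  by rewrite mul0r addr0.
- move=> n z; apply: le_trans (normr_phiM_le _ _ s1) _; rewrite lerD2r nE.
  apply: le_trans (normrD_powR_le _ _ (ltW s0)) _.
  rewrite ler_wpM2l ?powR_ge0// lerD2l ge0_ler_powR ?nnegrE ?(ltW s0)//.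
  by rewrite normrM ler_piMl// ger0_norm// invf_le1// ler1n.
Qed.

(** By Green's formula the claim is about the integral over [E] of (phi(\nabla u1) - phi(\nabla u2))
    \nabla p(u1 - u2). Both factors have the sign of \nabla u1 - \nabla u2, since [phi s] and [p]
    are nondecreasing. *)
Lemma laplacian_monotone (g p : R -> R) u1 u2 w1 w2 : slope_pair g p ->
  Delta s m nu u1 w1 -> Delta s m nu u2 w2 ->
  (\int[nu]_x ((w1 x - w2 x) * p (u1 x - u2 x)) <= 0)%R.
Proof.
move=> gp [u1L w1L u1i w1E] [u2L w2L u2i w2E].
have [mu1 _] := u1L; have [mu2 _] := u2L; have [mw1 _] := w1L; have [mw2 _] := w2L.
move/fin_energyP : u1i => /(_ mu1) u1i; move/fin_energyP : u2i => /(_ mu2) u2i.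
have tf := slope_pair_test_fun gp (L2B u1L u2L).
set f := (fun x => p (u1 x - u2 x)%R) in tf.
have [mf _] := tf; have fi := test_fun_energy rev s1 tf.
have [i1 e1] := green_test_fun rev s1 mu1 u1i mw1 w1E tf.
have [i2 e2] := green_test_fun rev s1 mu2 u2i mw2 w2E tf.
have -> : (\int[nu]_x ((w1 x - w2 x) * p (u1 x - u2 x)) =
    \int[nu]_x (w1 x * f x) - \int[nu]_x (w2 x * f x))%R.
  by rewrite -rintegralB//; apply: rintegral_ext => x; rewrite /f; ring.
have p1 := phi_nablaM_integrable s1 mu1 mf u1i fi.
have p2 := phi_nablaM_integrable s1 mu2 mf u2i fi.
suff : (0 <= \int[E]_z (phi s (nabla u1 z) * nabla f z) -
             \int[E]_z (phi s (nabla u2 z) * nabla f z))%R by rewrite e1 e2; lra.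
rewrite -rintegralB//; apply: Rintegral_ge0 => z _.
rewrite -mulrBl {2}/nabla /f.
have [h|h] := leP (nabla u1 z) (nabla u2 z).
- have h1 := phi_nondecreasing s1 h.
  rewrite -mulrNN mulr_ge0// ?opprB ?subr_ge0//.
  by apply: (slope_pair_nondecreasing gp); move: h; rewrite /nabla; lra.
- have h1 := phi_nondecreasing s1 (ltW h).
  rewrite mulr_ge0// ?subr_ge0//.
  by apply: (slope_pair_nondecreasing gp); move: h; rewrite /nabla; lra.
Qed.

End laplacian_estimates.

(** * The sum of two energies *)
Section two_random_walks.
Context d (X : measurableType d) (R : realType).
Variables (m1 m2 : R.-pker X ~> X) (nu1 nu2 : {measure set X -> \bar R}).
Variables (mu : X -> R) (q p c M : R).
Hypotheses (q1 : (1 < q)%R) (p1 : (1 < p)%R).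
Hypotheses (rev1 : reversible m1 nu1) (rev2 : reversible m2 nu2).
Hypotheses (mmu : measurable_fun setT mu) (c0 : (0 < c)%R).
Hypotheses (cmu : forall x, (c <= mu x)%R) (muM : forall x, (mu x <= M)%R).
Hypothesis nu2E : forall A, measurable A -> nu2 A = \int[nu1]_(x in A) (mu x)%:E.
Implicit Types u v w f : X -> R.

Local Notation F := (fun w => Fsm q m1 nu1 w + Fsm p m2 nu2 w).
Local Notation B := (opB q p m1 m2 nu1 nu2 mu).

Let mu0 x : (0 <= mu x)%R. Proof. exact: le_trans (ltW c0) (cmu x). Qed.

Lemma ge0_integral_nu2 f : measurable_fun setT f -> (forall x, 0 <= f x)%R ->
  \int[nu2]_x (f x)%:E = \int[nu1]_x (mu x * f x)%:E.
Proof.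
move=> mf f0; rewrite (ge0_integral_density mmu mu0 nu2E)//.
exact/measurable_EFinP.
Qed.

(** The bounds c <= mu <= M make the two measures comparable, so integrability, L^2 and null sets
    may be moved freely between them. *)
Lemma rintegrable_nu2 f : measurable_fun setT f ->
  rintegrable nu2 f <-> rintegrable nu1 f.
Proof.
move=> mf; have mn : measurable_fun setT (fun x => `|f x|)%R by exact: measurableT_comp.
split=> [fi|fi].
- have mfi : rintegrable nu1 (fun x => mu x * `|f x|)%R.
    apply: rintegrable_ge0; first exact: measurable_funM.
      by move=> x; rewrite mulr_ge0.
    by rewrite -ge0_integral_nu2//; case/integrableP : fi.
  apply: rintegrable_le (rintegrableZ c^-1 mfi) mf _ => x.
  by rewrite mulrA ler_peMl// mulrC ler_pdivlMr// mul1r.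
- apply/integrableP; split; first exact/measurable_EFinP.
  rewrite -[X in X < _]/(\int[nu2]_x (`|f x|%R)%:E) ge0_integral_nu2//.
  have mfi : rintegrable nu1 (fun x => mu x * `|f x|)%R.
    apply: rintegrable_le (rintegrableZ M (integrable_norm fi)) _ _.
      exact: measurable_funM.
    by move=> x /=; rewrite ger0_norm ?mulr_ge0// ler_wpM2r.
  exact: integrable_lty measurableT _ mfi.
Qed.

Lemma rintegrable_muM f : rintegrable nu2 f -> rintegrable nu1 (fun x => mu x * f x)%R.
Proof.
move=> fi; have mf := rintegrable_measurable fi; move/(rintegrable_nu2 mf) : fi => fi.
apply: rintegrable_le (rintegrableZ M (integrable_norm fi)) _ _.
  exact: measurable_funM.
by move=> x /=; rewrite normrM (ger0_norm (mu0 x)) ler_wpM2r.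
Qed.

Lemma rintegral_nu2 f : rintegrable nu2 f ->
  (\int[nu2]_x f x = \int[nu1]_x (mu x * f x))%R.
Proof.
move=> fi; have mf := rintegrable_measurable fi.
have ge0 (g : X -> R) : measurable_fun setT g -> (forall x, 0 <= g x)%R ->
    (\int[nu2]_x g x = \int[nu1]_x (mu x * g x))%R.
  by move=> mg g0; rewrite /Rintegral ge0_integral_nu2.
have ni : rintegrable nu2 (fun x => `|f x|)%R by exact: integrable_norm.
have si := rintegrableD fi ni.
(* A signed function is the difference of the nonnegative functions f + |f| and |f|. *)
transitivity (\int[nu2]_x (f x + `|f x|) - \int[nu2]_x `|f x|)%R.
  by rewrite -rintegralB//; apply: rintegral_ext => x; ring.
rewrite !ge0; first last.
- by move=> x; have := ler_norm (- f x); rewrite normrN; lra.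
- exact: rintegrable_measurable si.
- by [].
- exact: rintegrable_measurable ni.
rewrite -rintegralB; [|exact: rintegrable_muM|exact: rintegrable_muM].
by apply: rintegral_ext => x; ring.
Qed.

Lemma L2_nu2 f : L2 nu2 f <-> L2 nu1 f.
Proof.
split=> /L2P[mf fi]; apply/L2P; split => //; apply/rintegrable_nu2 => //;
  exact: measurable_funX.
Qed.

Lemma test_fun_nu2 f : test_fun nu1 f -> test_fun nu2 f.
Proof.
move=> [mf [K [A [mA nuA K0 fA]]]]; split => //; exists K, A; split => //.
have : rintegrable nu2 (\1_A : X -> R).
  by apply/rintegrable_nu2 => //; exact: rintegrable_indic.
by move=> /(integrable_lty measurableT); rewrite integral_indic// setIT.
Qed.

Lemma ae_nu2 (P : X -> Prop) : {ae nu2, forall x, P x} <-> {ae nu1, forall x, P x}.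
Proof.
split=> -[N [mN nuN PN]]; exists N; split => //.
- apply/eqP; rewrite -measure_le0 -(@pmule_rle0 _ c%:E) ?lte_fin//.
  rewrite -nuN nu2E// -integral_cst//.
  apply: ge0_le_integral => //.
  + by move=> x _; rewrite lee_fin ltW.
  + by apply/measurable_EFinP; exact: measurable_funTS.
  + by move=> x _; rewrite lee_fin.
- rewrite nu2E//; apply: null_set_integral => //.
  by apply/measurable_EFinP; exact: measurable_funTS.
Qed.

Lemma split_rintegral v w1 w2 f : measurable_fun setT v -> measurable_fun setT f ->
  {ae nu1, forall x, v x = (- w1 x - mu x * w2 x)%R} ->
  rintegrable nu1 (fun x => w1 x * f x)%R -> rintegrable nu2 (fun x => w2 x * f x)%R ->
  (\int[nu1]_x (v x * f x) =
   - (\int[nu1]_x (w1 x * f x)) - \int[nu2]_x (w2 x * f x))%R.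
Proof.
move=> mv mf vE i1 i2; have j2 := rintegrable_muM i2.
rewrite rintegral_nu2// -mulN1r -rintegralZ// -rintegralB//; last exact: rintegrableZ.
apply: rintegral_ae.
- exact: measurable_funM.
- exact: rintegrable_measurable (rintegrableB (rintegrableZ (-1) i1) j2).
- by apply: filterS vE => x ->; ring.
Qed.

Lemma sum_Fsm_lty w : Fsm q m1 nu1 w + Fsm p m2 nu2 w < +oo ->
  Fsm q m1 nu1 w < +oo /\ Fsm p m2 nu2 w < +oo.
Proof.
have := Fsm_ge0 m1 nu1 q1 w; have := Fsm_ge0 m2 nu2 p1 w.
by case: (Fsm q m1 nu1 w) => [r||]//; case: (Fsm p m2 nu2 w) => [t||]// *; rewrite !ltry.
Qed.

Lemma opB_subdiff u v : B u v -> subdiff nu1 F u v.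
Proof.
move=> [uL vL [w1 [w2 [D1 D2 vE]]]]; have [mu' _] := uL; have [mv _] := vL.
have [_ w1L /(fin_energyP m1 nu1 q mu') e1 _] := D1.
have [_ w2L /(fin_energyP m2 nu2 p mu') e2 _] := D2.
split => //; first by rewrite (FsmE mu' e1) (FsmE mu' e2) -EFinD.
move=> w wL; have [mw _] := wL.
have [|Fy] := ltP (Fsm q m1 nu1 w + Fsm p m2 nu2 w) +oo; last first.
  exact: le_trans (leey _) Fy.
move=> /sum_Fsm_lty[/(Fsm_fin_energy q1 mw) f1 /(Fsm_fin_energy p1 mw) f2].
rewrite (FsmE mu' e1) (FsmE mu' e2) (FsmE mw f1) (FsmE mw f2).
have wuL := L2B wL uL; have [mwu _] := wuL.
rewrite (rintegralE (L2M vL wuL)) -!EFinD lee_fin.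
rewrite (split_rintegral mv mwu vE (L2M w1L wuL)); last first.
  by apply: L2M => //; exact/L2_nu2.
have h1 := energy_laplacian rev1 q1 D1 wL f1.
have h2 := energy_laplacian rev2 p1 D2 (proj2 (L2_nu2 w) wL) f2.
apply: le_trans (lerD h1 h2).
by rewrite le_eqVlt; apply/orP; left; apply/eqP; ring.
Qed.

Lemma subdiff_fin_energy u v : subdiff nu1 F u v ->
  [/\ L2 nu1 u, L2 nu1 v, fin_energy m1 nu1 q u & fin_energy m2 nu2 p u].
Proof.
move=> [uL vL Ffin _]; have [mu' _] := uL.
have [] : Fsm q m1 nu1 u < +oo /\ Fsm p m2 nu2 u < +oo.
  by apply: sum_Fsm_lty; move: Ffin; rewrite ltey_eq => ->.
by move=> /(Fsm_fin_energy q1 mu') e1 /(Fsm_fin_energy p1 mu') e2.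
Qed.

(** Compares the subdifferential inequality at u + t f with the upper bounds of
    [energy_directional]; the energies cancel. *)
Let quotient_le (a1 a2 b1 b2 V I J t : R) : (a1 + a2 + t * V <= b1 + b2)%R ->
  (b1 <= a1 + t / 2 * I)%R -> (b2 <= a2 + t / 2 * J)%R ->
  (t * V <= t * (2^-1 * (I + J)))%R.
Proof. by lra. Qed.

(** Test with u + t f for t = 1/(n + 1), divide by t and let n tend to infinity by [phi_nabla_cvg];
    Green's formula identifies the limit. Replacing f by - f then gives equality. *)
Lemma subdiff_weak_le u v f : subdiff nu1 F u v -> test_fun nu1 f ->
  (\int[nu1]_x (v x * f x) <= - (\int[nu1]_x (laplacian m1 q u x * f x))
     - \int[nu2]_x (laplacian m2 p u x * f x))%R.
Proof.
move=> sub tf; have [uL vL e1 e2] := subdiff_fin_energy sub.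
have [_ _ _ Fsub] := sub; have [mu' _] := uL; have [mf _] := tf.
have tf2 := test_fun_nu2 tf.
have [_ g1] := green_test_fun rev1 q1 mu' e1 (measurable_laplacian m1 q mu')
  (laplacianE q1 mu' e1) tf.
have [_ g2] := green_test_fun rev2 p1 mu' e2 (measurable_laplacian m2 p mu')
  (laplacianE p1 mu' e2) tf2.
have fL := test_fun_L2 tf.
pose I1 n := (\int[edge m1 nu1]_z
  (phi q (nabla (fun x => u x + n.+1%:R^-1 * f x) z) * nabla f z))%R.
pose I2 n := (\int[edge m2 nu2]_z
  (phi p (nabla (fun x => u x + n.+1%:R^-1 * f x) z) * nabla f z))%R.
have le_n n : (\int[nu1]_x (v x * f x) <= 2^-1 * (I1 n + I2 n))%R.
  pose t : R := (n.+1%:R^-1)%R; have t0 : (0 < t)%R by rewrite invr_gt0.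
  have [f1 h1] := energy_directional rev1 q1 t mu' e1 tf.
  have [f2 h2] := energy_directional rev2 p1 t mu' e2 tf2.
  have wL := L2D uL (L2Z t fL); have [mw _] := wL.
  have := Fsub _ wL.
  rewrite (FsmE mu' e1) (FsmE mu' e2) (FsmE mw f1) (FsmE mw f2).
  have -> : \int[nu1]_x (v x * (u x + t * f x - u x))%:E =
      (t * \int[nu1]_x (v x * f x))%:E.
    rewrite -rintegralZ; last exact: L2M.
    rewrite -rintegralE; last by apply: rintegrableZ; exact: L2M.
    by apply: eq_integral => x _; congr EFin; ring.
  rewrite -!EFinD lee_fin => h.
  rewrite -(ler_pM2l t0) /I1 /I2 -/t.
  exact: quotient_le h h1 h2.
have cv : (2^-1 * (I1 n + I2 n))%R @[n --> \oo] -->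
   (2^-1 * (\int[edge m1 nu1]_z (phi q (nabla u z) * nabla f z) +
            \int[edge m2 nu2]_z (phi p (nabla u z) * nabla f z)))%R.
  apply: cvgM; first exact: cvg_cst.
  by apply: cvgD; exact: phi_nabla_cvg.
have -> : (- (\int[nu1]_x (laplacian m1 q u x * f x)) -
    \int[nu2]_x (laplacian m2 p u x * f x) =
    2^-1 * (\int[edge m1 nu1]_z (phi q (nabla u z) * nabla f z) +
            \int[edge m2 nu2]_z (phi p (nabla u z) * nabla f z)))%R.
  by rewrite g1 g2; field.
rewrite -(cvg_lim _ cv)//; apply: limr_ge; first by apply/cvg_ex; eexists; exact: cv.
exact: nearW.
Qed.

Lemma subdiff_weak u v f : subdiff nu1 F u v -> test_fun nu1 f ->
  (\int[nu1]_x (v x * f x) = - (\int[nu1]_x (laplacian m1 q u x * f x))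
     - \int[nu2]_x (laplacian m2 p u x * f x))%R.
Proof.
move=> sub tf; apply/eqP; rewrite eq_le subdiff_weak_le//=.
have := subdiff_weak_le sub (test_funZ (-1) tf).
have [uL vL e1 e2] := subdiff_fin_energy sub; have [mu' _] := uL; have fL := test_fun_L2 tf.
have [i1 _] := green_test_fun rev1 q1 mu' e1 (measurable_laplacian m1 q mu')
  (laplacianE q1 mu' e1) tf.
have [i2 _] := green_test_fun rev2 p1 mu' e2 (measurable_laplacian m2 p mu')
  (laplacianE p1 mu' e2) (test_fun_nu2 tf).
have N (nu : {measure set X -> \bar R}) (g : X -> R) : rintegrable nu (fun x => g x * f x)%R ->
    (\int[nu]_x (g x * (-1 * f x)) = - \int[nu]_x (g x * f x))%R.
  by move=> gi; rewrite -[RHS]mulN1r -rintegralZ//; apply: rintegral_ext => x; ring.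
by rewrite !N//; [clear sub; lra|exact: L2M].
Qed.

(** The defect [h] is so far only known to be integrable on sets of finite measure. Testing with
    their indicators gives it zero integral on each of them, hence [h] vanishes a.e. on every piece
    of a sigma-finite cover. *)
Lemma subdiff_ae u v : sigma_finite setT nu1 -> subdiff nu1 F u v ->
  {ae nu1, forall x, v x = (- laplacian m1 q u x - mu x * laplacian m2 p u x)%R}.
Proof.
move=> [A UA Afin] sub; have [uL vL e1 e2] := subdiff_fin_energy sub.
have [mu' _] := uL; have [mv _] := vL.
pose h x := (v x + laplacian m1 q u x + mu x * laplacian m2 p u x)%R.
have mh : measurable_fun setT h.
  apply: measurable_funD; first by apply: measurable_funD => //; exact: measurable_laplacian.
  by apply: measurable_funM => //; exact: measurable_laplacian.
have hD D : measurable D -> nu1 D < +oo ->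
    rintegrable nu1 (fun x => h x * \1_D x)%R /\ (\int[nu1]_x (h x * \1_D x) = 0)%R.
  move=> mD nuD; have tf : test_fun nu1 (\1_D : X -> R).
    split => //; exists 1%R, D; split => // x; rewrite mul1r ger0_norm//.
  have [i1 _] := green_test_fun rev1 q1 mu' e1 (measurable_laplacian m1 q mu')
    (laplacianE q1 mu' e1) tf.
  have [i2 _] := green_test_fun rev2 p1 mu' e2 (measurable_laplacian m2 p mu')
    (laplacianE p1 mu' e2) (test_fun_nu2 tf).
  have iv := L2M vL (test_fun_L2 tf); have j2 := rintegrable_muM i2.
  have hE x : (h x * \1_D x = v x * \1_D x + laplacian m1 q u x * \1_D x +
      mu x * (laplacian m2 p u x * \1_D x))%R by rewrite /h; ring.
  split.
    by apply: rintegrable_ext hE _; apply: rintegrableD => //; exact: rintegrableD.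
  rewrite (rintegral_ext nu1 hE) rintegralD//; last exact: rintegrableD.
  by rewrite rintegralD// -rintegral_nu2// (subdiff_weak sub tf); ring.
have patchE D : (fun x => (h x)%:E) \_ D = (fun x => (h x * \1_D x)%:E).
  by apply/funext => x; rewrite patchE indicE; case: ifP; rewrite ?mulr1 ?mulr0.
have hA n : {ae nu1, forall x, A n x -> (h x)%:E = cst 0 x}.
  have [mA nuA] := Afin n.
  apply: (@integral_ae_eq _ _ _ nu1 (A n) mA (cst 0) (fun x => (h x)%:E)) => //.
    by apply/integrable_mkcond => //; rewrite patchE; case: (hD _ mA nuA).
  move=> D DA mD; rewrite integral0 integral_mkcond patchE.
  have nuD : nu1 D < +oo by apply: le_lt_trans nuA; apply: le_measure; rewrite ?inE.
  by have [hi h0] := hD D mD nuD; rewrite (rintegralE hi) h0.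
have /ae_foralln := hA; apply: filterS => x hx.
have [n _ Anx] : (\bigcup_n A n) x by rewrite -UA.
by have [] := hx n Anx; rewrite /h; clear sub; lra.
Qed.

(** It remains to separate v into two L^2 terms. First w_1 is bounded directly on a set [A] of
    finite measure and through w_1 = - v - mu w_2 off it; then mu w_2 = - v - w_1 yields w_2. *)
Lemma subdiff_opB u v : sigma_finite setT nu1 -> (q <= 2)%R ->
  nu1 setT < +oo \/ (2 <= p)%R -> subdiff nu1 F u v -> B u v.
Proof.
move=> sf q2 ab sub; have vE := subdiff_ae sf sub.
have [uL vL e1 e2] := subdiff_fin_energy sub.
have [mu' _] := uL; have [mv _] := vL.
have mw1 := measurable_laplacian m1 q mu'; have mw2 := measurable_laplacian m2 p mu'.
have g1i := rintegrable_local_energy mu' e1.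
have g2i' := rintegrable_local_energy mu' e2.
have g2i : rintegrable nu1 (local_energy m2 p u).
  by apply/rintegrable_nu2 => //; exact: rintegrable_measurable g2i'.
have [A [mA nuA w2A]] : exists A, [/\ measurable A, nu1 A < +oo &
    {ae nu1, forall x, ~ A x -> (laplacian m2 p u x ^+ 2 <= 4 * local_energy m2 p u x)%R}].
  case: ab => [nufin|p2].
    by exists setT; split => //; apply: aeW => x /(_ I).
  (* The set where G_2 exceeds 1 has finite measure because G_2 is integrable. *)
  exists [set x | 1%:E < (local_energy m2 p u x)%:E].
  have mle := rintegrable_measurable g2i.
  have mA : measurable [set x | 1%:E < (local_energy m2 p u x)%:E].
    rewrite -[X in measurable X]setTI; apply: emeasurable_fun_o_infty => //.
    exact/measurable_EFinP.
  split => //.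
  - have : rintegrable nu1 (\1_[set x | 1%:E < (local_energy m2 p u x)%:E] : X -> R).
      apply: rintegrable_le g2i _ _ => // x; rewrite indicE ger0_norm//.
      case: (boolP (_ \in _)) => [|_]; last exact: local_energy_ge0.
      by rewrite inE/= lte_fin => /ltW.
    by move=> /(integrable_lty measurableT); rewrite integral_indic// setIT.
  - apply/ae_nu2; apply: filterS (laplacian_sqr_ge2 p1 p2 mu' e2) => x h /= /negP.
    by rewrite lte_fin -leNgt; exact: h.
have w1L : L2 nu1 (laplacian m1 q u).
  apply/L2P; split => //.
  have [_ vi] := proj1 (L2P nu1 v) vL.
  (* The first two terms bound w_1^2 on [A]; the last two bound (v + mu w_2)^2 off [A], using mu <=
     M and w_2^2 <= 4 G_2. *)
  have b := rintegrableD (rintegrableD (rintegrableZ 4 (rintegrable_indic mA nuA))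
    (rintegrableZ 4 g1i)) (rintegrableD (rintegrableZ 2 vi) (rintegrableZ (8 * M ^+ 2) g2i)).
  apply: rintegrable_le_ae b _ _; first exact: measurable_funX.
  have ae2 := @laplacian_sqr_le2 _ _ _ _ _ _ q1 u q2 mu' e1.
  move: vE w2A ae2; apply: filterS3 => x vx w2x w1x.
  rewrite normrX real_normK ?num_real// indicE.
  have g1 := local_energy_ge0 m1 q u x; have g2 := local_energy_ge0 m2 p u x.
  have v2 := sqr_ge0 (v x).
  have M2 : (0 <= 8 * M ^+ 2 * local_energy m2 p u x)%R.
    by rewrite mulr_ge0// mulr_ge0// sqr_ge0.
  case: (boolP (x \in A)) => [_|]; first by clear sub; rewrite /=; lra.
  rewrite notin_setE => /w2x {}w2x /=.
  have w1E : (laplacian m1 q u x = - v x - mu x * laplacian m2 p u x)%R.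
    by rewrite vx; ring.
  have mM : (mu x ^+ 2 <= M ^+ 2)%R by rewrite ler_sqr ?nnegrE//; exact: le_trans (muM x).
  have h1 : ((mu x * laplacian m2 p u x) ^+ 2 <= 4 * M ^+ 2 * local_energy m2 p u x)%R.
    rewrite exprMn; apply: (@le_trans _ _ (M ^+ 2 * (4 * local_energy m2 p u x))%R).
      by apply: ler_pM => //; exact: sqr_ge0.
    by rewrite mulrCA mulrA.
  have h2 := sqr_ge0 (v x - mu x * laplacian m2 p u x)%R.
  by rewrite w1E; clear sub; lra.
have w2L : L2 nu1 (laplacian m2 p u).
  apply/L2P; split => //.
  have [_ vi] := proj1 (L2P nu1 v) vL; have [_ w1i] := proj1 (L2P nu1 _) w1L.
  (* From c^2 w_2^2 <= (mu w_2)^2 = (v + w_1)^2 <= 2 (v^2 + w_1^2). *)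
  have bb := rintegrableZ (2 / c ^+ 2)%R (rintegrableD vi w1i).
  apply: rintegrable_le_ae bb _ _; first exact: measurable_funX.
  apply: filterS vE => x vx; rewrite normrX real_normK ?num_real//.
  have c2 : (0 < c ^+ 2)%R by rewrite exprn_gt0.
  rewrite mulrAC ler_pdivlMr// mulrC.
  apply: (@le_trans _ _ ((mu x * laplacian m2 p u x) ^+ 2)%R).
    rewrite exprMn ler_wpM2r ?sqr_ge0// ler_sqr ?nnegrE//; exact: ltW.
  have -> : (mu x * laplacian m2 p u x = - v x - laplacian m1 q u x)%R by rewrite vx; ring.
  by have := sqr_ge0 (v x - laplacian m1 q u x)%R; clear sub; lra.
split => //; exists (laplacian m1 q u), (laplacian m2 p u); split => //.
- by split => //; [exact/fin_energyP|exact: laplacianE].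
- by split => //; [exact/L2_nu2|exact/L2_nu2|exact/fin_energyP|exact: laplacianE].
Qed.

Lemma test_fun_opB u : test_fun nu1 u -> exists v, B u v.
Proof.
move=> tu; have tu2 := test_fun_nu2 tu; have [mu' _] := tu.
have e1 := test_fun_energy rev1 q1 tu; have e2 := test_fun_energy rev2 p1 tu2.
have w1L := laplacian_test_fun_L2 rev1 q1 tu.
have w2L := laplacian_test_fun_L2 rev2 p1 tu2.
have muw2L : L2 nu1 (fun x => mu x * laplacian m2 p u x)%R.
  have [mw2 /(rintegrable_nu2 (measurable_funX 2 (proj1 w2L))) w2i] := proj1 (L2P nu2 _) w2L.
  apply/L2P; split; first exact: measurable_funM.
  apply: rintegrable_le (rintegrableZ (M ^+ 2) w2i) _ _.
    by apply: measurable_funX; exact: measurable_funM.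
  move=> x; rewrite normrX real_normK ?num_real// exprMn ler_wpM2r ?sqr_ge0//.
  by rewrite ler_sqr ?nnegrE//; exact: le_trans (muM x).
have uL := test_fun_L2 tu.
exists (fun x => - laplacian m1 q u x - mu x * laplacian m2 p u x)%R; split => //.
  apply: L2_ext (L2B (L2Z (-1) w1L) muw2L) => x; ring.
exists (laplacian m1 q u), (laplacian m2 p u); split => //.
- by split => //; [exact/fin_energyP|exact: laplacianE].
- by split => //; [exact/L2_nu2|exact/fin_energyP|exact: laplacianE].
- exact: aeW.
Qed.

(** Soft truncations of f lie in the domain and converge to f in L^2, the squared error being
    dominated by 4 f^2. *)
Lemma opB_dense : dense_domain nu1 B.
Proof.
move=> f fL eps eps0; have [mf fi] := proj1 (L2P nu1 f) fL.
have [_ cv] : rintegrable nu1 (fun=> 0%R) /\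
    (\int[nu1]_x ((soft_trunc n (f x) - f x) ^+ 2))%R @[n --> \oo] -->
    (\int[nu1]_x (fun=> 0%R) x)%R.
  apply: (rintegral_dominated_cvg _ _ (rintegrableZ 4 fi)).
  - move=> n; apply: measurable_funX; apply: measurable_funB => //.
    exact: (measurableT_comp (measurable_soft_trunc n)).
  - move=> x; rewrite (_ : 0%R = (f x - f x) ^+ 2)%R; last by rewrite subrr expr0n.
    apply: (@cvg_comp _ _ _ (fun n => soft_trunc n (f x) - f x)%R (fun r => r ^+ 2)%R
      _ (nbhs (f x - f x)%R)); last exact: exprn_continuous.
    by apply: cvgB; [exact: soft_trunc_cvg|exact: cvg_cst].
  - move=> n x; rewrite normrX.
    rewrite (_ : 4 * f x ^+ 2 = (2 * `|f x|) ^+ 2)%R; last first.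
      by rewrite exprMn real_normK ?num_real//; ring.
    rewrite ler_sqr ?nnegrE ?mulr_ge0//.
    apply: le_trans (ler_normB _ _) _; have := normr_soft_trunc n (f x); lra.
have : \forall n \near \oo, (\int[nu1]_x ((soft_trunc n (f x) - f x) ^+ 2) < eps)%R.
  apply: (cvgr_lt _ cv); rewrite Rintegral_cst//= ?mul0r//.
move=> [n _ /(_ n (leqnn n))] /= h.
have tf := soft_trunc_test_fun n fL.
exists (fun x => soft_trunc n (f x)); split; first exact: test_fun_opB.
have [_ di] := proj1 (L2P nu1 _) (L2B (test_fun_L2 tf) fL).
by rewrite (rintegralE di) lte_fin.
Qed.

Lemma opB_slope_pair (g r : R -> R) (lam : R) u1 v1 u2 v2 : slope_pair g r ->
  (0 < lam)%R -> B u1 v1 -> B u2 v2 ->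
  \int[nu1]_x (g (u1 x - u2 x))%:E <=
  \int[nu1]_x (g (u1 x - u2 x + lam * (v1 x - v2 x)))%:E.
Proof.
move=> gr lam0 [u1L v1L [a1 [a2 [D1 D2 v1E]]]] [u2L v2L [b1 [b2 [E1 E2 v2E]]]].
have uL := L2B u1L u2L; have vL := L2B v1L v2L.
have tf := slope_pair_test_fun gr uL.
have zL := L2D uL (L2Z lam vL).
have gi := slope_pair_integrable gr uL; have gzi := slope_pair_integrable gr zL.
rewrite (rintegralE gi) (rintegralE gzi) lee_fin.
have fv := L2M vL (test_fun_L2 tf).
have h1 := laplacian_monotone rev1 q1 gr D1 E1.
have h2 := laplacian_monotone rev2 p1 gr D2 E2.
have [_ a1L _ _] := D1; have [_ a2L _ _] := D2.
have [_ b1L _ _] := E1; have [_ b2L _ _] := E2.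
have vE : {ae nu1, forall x, (v1 x - v2 x =
    - (a1 x - b1 x) - mu x * (a2 x - b2 x))%R}.
  by apply: filterS2 v1E v2E => x -> ->; ring.
have hv := split_rintegral (proj1 vL) (proj1 tf) vE
  (L2M (L2B a1L b1L) (test_fun_L2 tf))
  (L2M (L2B a2L b2L) (test_fun_L2 (test_fun_nu2 tf))).
have {h1 h2}hv0 : (0 <= \int[nu1]_x ((v1 x - v2 x) * r (u1 x - u2 x)))%R.
  by rewrite hv; lra.
(* The subgradient inequality of [g] at u1 - u2 with increment lam (v1 - v2); the linear term has
   nonnegative integral. *)
apply: (@le_trans _ _ (\int[nu1]_x (g (u1 x - u2 x) +
    lam * ((v1 x - v2 x) * r (u1 x - u2 x))))%R).
  rewrite rintegralD//; last exact: rintegrableZ.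
  by rewrite rintegralZ// lerDl mulr_ge0// ltW.
apply: rintegral_le => //.
  by apply: rintegrableD => //; exact: rintegrableZ.
move=> x; have [_ _ _ h _] := gr.
have := h (u1 x - u2 x)%R (u1 x - u2 x + lam * (v1 x - v2 x))%R.
by congr (_ + _ <= _)%R; ring.
Qed.

Lemma opB_completely_accretive : completely_accretive nu1 B.
Proof.
move=> lam u1 v1 u2 v2 lam0 B1 B2 j jc jl j0 j00.
have [[mu1 _] [mv1 _] _] := B1; have [[mu2 _] [mv2 _] _] := B2.
have mj := lower_semicontinuous_measurable jl.
pose G n := (convex_approx j n).1.
have mG n : measurable_fun setT (G n) by case: (convex_approx_slope_pair j n).
have G0 n r : (0 <= G n r)%R.
  by have [_ _ h _ _] := convex_approx_slope_pair j n; exact: h.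
have mu12 : measurable_fun setT (fun x => u1 x - u2 x)%R by exact: measurable_funB.
have mz : measurable_fun setT (fun x => u1 x - u2 x + lam * (v1 x - v2 x))%R.
  apply: measurable_funD => //; apply: measurable_funM => //.
  exact: measurable_funB.
have : \int[nu1]_x (G n (u1 x - u2 x))%:E @[n --> \oo] --> \int[nu1]_x j (u1 x - u2 x)%R.
  rewrite (_ : (fun x => j (u1 x - u2 x)%R) =
    (fun x => limn (fun n => (G n (u1 x - u2 x))%:E))); last first.
    apply/funext => x; apply/esym/cvg_lim => //; exact: convex_approx_cvg.
  apply: cvg_monotone_convergence => //.
  - by move=> n; apply/measurable_EFinP; exact: measurableT_comp.
  - by move=> n x _; rewrite lee_fin.
  - by move=> x _ n k nk; exact: convex_approx_nd.
(* A limit is needed only on the left-hand side; on the right each approximant is already below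
   [j]. *)
move=> cv; rewrite -(cvg_lim _ cv)//; apply: lime_le.
  by apply/cvg_ex; eexists; exact: cv.
apply: nearW => n.
apply: le_trans (opB_slope_pair (convex_approx_slope_pair j n) lam0 B1 B2) _.
apply: ge0_le_integral => //.
- by move=> x _; rewrite lee_fin; exact: G0.
- by apply/measurable_EFinP; exact: (measurableT_comp (mG n)).
- exact: (measurableT_comp mj).
- by move=> x _; exact: convex_approx_le.
Qed.

End two_random_walks.

(** * Passing to a density bounded everywhere, and conclusion *)

Lemma opB_ae d (X : measurableType d) (R : realType) (m1 m2 : R.-pker X ~> X)
    (nu1 nu2 : {measure set X -> \bar R}) (mu mu' : X -> R) (q p : R) u v :
  {ae nu1, forall x, mu x = mu' x} ->
  opB q p m1 m2 nu1 nu2 mu u v -> opB q p m1 m2 nu1 nu2 mu' u v.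
Proof.
move=> mumu' [uL vL [w1 [w2 [D1 D2 vE]]]]; split => //; exists w1, w2; split => //.
by apply: filterS2 mumu' vE => x <-.
Qed.

Theorem theorem3p9 (d : measure_display) (X : measurableType d) (R : realType)
    (m1 m2 : R.-pker X ~> X) (nu1 nu2 : {measure set X -> \bar R})
    (mu : X -> R) (q p c : R) :
  @countably_generated d X ->
  (1 < q <= 2)%R -> (1 < p)%R ->
  random_walk_space m1 nu1 -> reversible m1 nu1 ->
  random_walk_space m2 nu2 -> reversible m2 nu2 ->
  nu2 `<< nu1 ->
  (* mu = d nu2 / d nu1 *)
  measurable_fun setT mu ->
  (forall A, measurable A -> nu2 A = \int[nu1]_(x in A) (mu x)%:E) ->
  (* mu \in L^oo(X, nu1) *)
  (exists M : R, {ae nu1, forall x, `|mu x| <= M}%R) ->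
  (0 < c)%R -> {ae nu1, forall x, c <= mu x}%R ->
  (nu1 setT < +oo \/
   (nu1 setT = +oo /\ (q <= p / (p - 1) <= 2)%R /\ (2 <= p)%R)) ->
  (forall u v, subdiff nu1 (fun w => Fsm q m1 nu1 w + Fsm p m2 nu2 w) u v <->
               opB q p m1 m2 nu1 nu2 mu u v) /\
  completely_accretive nu1 (opB q p m1 m2 nu1 nu2 mu) /\
  dense_domain nu1 (opB q p m1 m2 nu1 nu2 mu).
Proof.
move=> _ /andP[q1 q2] p1 [sf _] rev1 _ rev2 _ mmu nu2E [M muM] c0 cmu ab.
(* A representative of the density bounded on both sides everywhere. *)
pose mu' x := Num.max c (Num.min (mu x) M).
have mumu' : {ae nu1, forall x, mu x = mu' x}.
  apply: filterS2 muM cmu => x; rewrite ler_norml => /andP[_ xM] cx.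
  by rewrite /mu' min_l// max_r.
have mmu' : measurable_fun setT mu'.
  by apply: measurable_maxr => //; exact: measurable_minr.
have cmu' x : (c <= mu' x)%R by rewrite /mu' le_max lexx.
(* The clipping at [c] comes last and [M] could lie below [c] when [nu1] is zero; c + |M| is a bound
   in all cases. *)
have muM' x : (mu' x <= c + `|M|)%R.
  have M1 := ler_norm M; have M0 := normr_ge0 M; rewrite /mu'.
  by case: (leP (mu x) M) => ?; case: (leP c _) => ?; lra.
have nu2E' A : measurable A -> nu2 A = \int[nu1]_(x in A) (mu' x)%:E.
  move=> mA; rewrite nu2E//; apply: ae_eq_integral => //.
  - by apply/measurable_EFinP; exact: measurable_funTS.
  - by apply/measurable_EFinP; exact: measurable_funTS.
  - by apply: filterS mumu' => x ->.
have to' u v := @opB_ae _ _ _ m1 m2 nu1 nu2 mu mu' q p u v mumu'.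
have from' u v : opB q p m1 m2 nu1 nu2 mu' u v -> opB q p m1 m2 nu1 nu2 mu u v.
  by apply: opB_ae; apply: filterS mumu' => x ->.
have {}ab : nu1 setT < +oo \/ (2 <= p)%R.
  by case: ab => [|[_ [_ p2]]]; [left|right].
split; last split.
- move=> u v; split.
  + by move=> sub; apply: from'; exact: (subdiff_opB q1 p1 rev1 rev2 mmu' c0 cmu' muM' nu2E').
  + by move=> /to'; exact: (opB_subdiff q1 p1 rev1 rev2 mmu' c0 cmu' muM' nu2E').
- move=> lam u1 v1 u2 v2 lam0 /to' B1 /to' B2.
  exact: (opB_completely_accretive q1 p1 rev1 rev2 mmu' c0 cmu' muM' nu2E' lam0 B1 B2).
- move=> f fL eps eps0.
  have [u [[v uv] ufe]] :=
    opB_dense q1 p1 rev1 rev2 mmu' c0 cmu' muM' nu2E' fL eps0.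
  by exists u; split => //; exists v; exact: from'.
Qed.
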